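(* Let $\alpha\in(0,1)$, let $f$ and $g$ be Laplace-transformable functions, let $A$ be a constant, and put $k=\frac{1-\alpha}{B(\alpha)}A$. The unique Laplace-transformable solution $f$ to the equation $$ {}^{ABR}D^{\alpha}_{0+}f(t)-Af(t)=g(t) $$ is given by either of the two equivalent expressions $$ f(t)=\frac{1}{1-k}\,{}^{AB}I^{\alpha}_{0+}h(t)+\frac{1}{1-k}\int_0^t\frac{\mathrm{d}}{\mathrm{d}t}E_{\alpha}\Big(\frac{k\alpha}{(1-k)(1-\alpha)}(t-x)^{\alpha}\Big)\,{}^{AB}I^{\alpha}_{0+}h(x)\,\mathrm{d}x $$ and $$ f(t)=\frac{k}{A(1-k)}h(t)+\frac{1}{A(1-k)}\int_0^t\frac{\mathrm{d}}{\mathrm{d}t}E_{\alpha}\Big(\frac{k\alpha}{(1-k)(1-\alpha)}(t-x)^{\alpha}\Big)h(x)\,\mathrm{d}x, $$ where $$ h(t)=g(t)+\Big[{}^{ABR}D^{\alpha}_{0+}\circ{}^{RL}I^{1}_{0+}f(0)\Big]\delta(t). $$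
   Context: The Mittag-Leffler function is $E_\alpha(x)=\sum_{n=0}^\infty \frac{x^n}{\Gamma(\alpha n+1)}$. $B$ is a fixed normalisation function with real, strictly positive values and $B(0)=B(1)=1$. The ABR fractional derivative is $$ {}^{ABR}D^{\alpha}_{0+}f(t)=\frac{B(\alpha)}{1-\alpha}\frac{\mathrm{d}}{\mathrm{d}t}\int_0^t f(x)E_\alpha\Big(\frac{-\alpha}{1-\alpha}(t-x)^{\alpha}\Big)\,\mathrm{d}x. $$ The Riemann--Liouville fractional integral is ${}^{RL}I^{\nu}_{0+}f(t)=\frac{1}{\Gamma(\nu)}\int_0^t(t-\tau)^{\nu-1}f(\tau)\,\mathrm{d}\tau$ for $\nu>0$, and the AB fractional integral is ${}^{AB}I^{\alpha}_{0+}f(t)=\frac{1-\alpha}{B(\alpha)}f(t)+\frac{\alpha}{B(\alpha)}{}^{RL}I^{\alpha}_{0+}f(t)$. The notation ${}^{ABR}D^{\alpha}_{0+}\circ{}^{RL}I^{1}_{0+}f(0)$ means the value at $t=0$ (the lower limit) of the function ${}^{ABR}D^{\alpha}_{0+}({}^{RL}I^{1}_{0+}f)$; $\delta$ is the Dirac delta, whose Laplace transform is taken to be $1$. A function is Laplace-transformable if it has a well-defined Laplace transform. *)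

(* Defs.v *)
From mathcomp Require Import all_boot all_order all_algebra.
From mathcomp Require Import all_classical all_reals all_analysis.
Set Implicit Arguments.
Unset Strict Implicit.
Unset Printing Implicit Defensive.
Import Order.TTheory GRing.Theory Num.Theory.
Import numFieldNormedType.Exports.
Local Open Scope classical_set_scope.
Local Open Scope ring_scope.

(* All functions live on the half-line [0, +oo[; they are given as total
   functions R -> R whose values at negative arguments are never used. *)

Section Defs.
Context {R : realType}.
Implicit Types (f u : R -> R) (nu alpha t : R) (B : R -> R).

Definition Gamma (x : R) : R :=
  \int[lebesgue_measure]_(t in `]0, +oo[) (t `^ (x - 1) * expR (- t)).

Definition mittag_leffler alpha (x : R) : R :=
  limn (series (fun n : nat => x ^+ n / Gamma (alpha * n%:R + 1))).

(* The classical (improper) Laplace integral: f is Lebesgue integrable on every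
   bounded interval, and the integral of exp(-sx) f(x) over [0, T] converges as
   T --> +oo, for all s in some right half-line. *)
Definition laplace_transformable f : Prop :=
  (forall T : R, lebesgue_measure.-integrable `[0, T] (EFin \o f)) /\
  exists s0 : R, forall s : R, s0 < s ->
    cvg ((\int[lebesgue_measure]_(x in `[0, T]) (expR (- (s * x)) * f x))
           @[T --> +oo]).

(* Derivative on [0, +oo[: two-sided at t > 0, right derivative at t = 0. *)
Definition diff_quotient (F : R -> R) t (h : R) : R := (F (t + h) - F t) / h.

Definition increments t : set_system R := within [set h | 0 <= t + h] 0^'.

Definition derivable_halfline (F : R -> R) t : Prop :=
  cvg (diff_quotient F t h @[h --> increments t]).

Definition deriv_halfline (F : R -> R) t : R :=
  lim (diff_quotient F t h @[h --> increments t]).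

Definition ABR_integral alpha f t : R :=
  \int[lebesgue_measure]_(x in `[0, t])
    (f x * mittag_leffler alpha (- alpha / (1 - alpha) * (t - x) `^ alpha)).

Definition ABR B alpha f t : R :=
  B alpha / (1 - alpha) * deriv_halfline (ABR_integral alpha f) t.

(* [lim] has a junk value when the limit does not exist, so existence of the
   derivative is recorded separately. *)
Definition ABR_derivable alpha f t : Prop :=
  derivable_halfline (ABR_integral alpha f) t.

(* Sums [u(t) + c delta(t)] of a function on [0, +oo[ and a multiple of the
   Dirac delta at 0, encoded as the pair (u, c); addition and scaling are those
   of the product module.  Such a sum stands for the signed measure
   u(x) dx + c \d_0 on [0, +oo[. *)
Definition genfun : Type := ((R -> R^o) * R^o)%type.

Definition regular (u : R -> R) : genfun := (u, 0).

Definition delta : genfun := (0, 1).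

(* Integral of K against the measure w over [0, t]. In particular delta
   integrates K to K 0 (for t >= 0), so its Laplace transform is 1. *)
Definition gint (t : R) (K : R -> R) (w : genfun) : R :=
  \int[lebesgue_measure]_(x in `[0, t]) (K x * w.1 x) +
  w.2 * \int[\d_(0 : R)]_(x in `[0, t]) K x.

(* Equality of measures: equal multiples of delta, and functions equal almost
   everywhere on [0, +oo[. *)
Definition genfun_eq (v w : genfun) : Prop :=
  {ae lebesgue_measure, forall t : R, 0 <= t -> v.1 t = w.1 t} /\ v.2 = w.2.

Definition RLI nu (w : genfun) t : R :=
  (Gamma nu)^-1 * gint t (fun x => (t - x) `^ (nu - 1)) w.

Definition ABI B alpha (w : genfun) : genfun :=
  ((1 - alpha) / B alpha) *: w + (alpha / B alpha) *: regular (RLI alpha w).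

(* Equality holds almost everywhere on [0, +oo[. *)
Definition ABR_solution B alpha (A : R) (g f : R -> R) : Prop :=
  {ae lebesgue_measure, forall t : R, 0 <= t ->
    ABR_derivable alpha f t /\ ABR B alpha f t - A * f t = g t}.

Definition forcing B alpha (g f : R -> R) : genfun :=
  regular g + ABR B alpha (RLI 1 (regular f)) 0 *: delta.

Definition ML_kernel alpha (k t x : R) : R :=
  derive1 (fun r : R => mittag_leffler alpha
    (k * alpha / ((1 - k) * (1 - alpha)) * (r - x) `^ alpha)) t.

Definition solution_AB B alpha (k : R) (h : genfun) : genfun :=
  (1 - k)^-1 *: ABI B alpha h +
  (1 - k)^-1 *: regular (fun t => gint t (ML_kernel alpha k t) (ABI B alpha h)).

Definition solution_direct alpha (A k : R) (h : genfun) : genfun :=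
  (k / (A * (1 - k))) *: h +
  (A * (1 - k))^-1 *: regular (fun t => gint t (ML_kernel alpha k t) h).

End Defs.

(* Main.v *)
Require Import Defs.
From mathcomp Require Import all_boot all_order all_algebra.
From mathcomp Require Import all_classical all_reals all_analysis.
From mathcomp Require Import measurable_realfun ring lra.
Set Implicit Arguments.
Unset Strict Implicit.
Unset Printing Implicit Defensive.
Import Order.TTheory GRing.Theory Num.Theory.
Import numFieldNormedType.Exports.
Local Open Scope classical_set_scope.
Local Open Scope ring_scope.

(** Write [u * v] for the convolution on the half-line and put
[c = alpha / (1 - alpha)], [gam = (1 - alpha) / B alpha], [l = k c / (1 - k)].
Let [phi] be the kernel [t^(alpha - 1) / Gamma alpha] of the fractional
integral and, for a real [m], let [p_m] be the Mittag-Leffler kernel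
[sum_n m^n t^(alpha n + alpha - 1) / Gamma (alpha n + alpha)].

Two facts about these kernels carry the proof.  First, the function
[t |-> E_alpha (m t^alpha)] is 1 plus [m] times the primitive of [p_m]
([mittag_lefflerE]).  Hence the integral defining the ABR derivative of a
locally integrable [f] is a primitive of [f - c (p_(-c) * f)]
([ABR_integralE]); by Lebesgue's theorem it is derivable almost everywhere, and
the fractional equation is the Volterra equation of the second kind
[f - c (p_(-c) * f) - k f = gam g] ([ABR_solutionE]).  Secondly,
[p_m = phi + m (phi * p_m)] ([mlkernel_resolvent]), which says that the
convolution operators [1 + m p_m] and [1 - m phi] are inverse to each other, for
every [m].  Applying [1 + c phi], the inverse of [1 - c p_(-c)], turns the
Volterra equation into
[(1 - k) (f - l (phi * f)) = gam (g + c (phi * g))], whose right-hand side is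
the AB integral of [g].  Applying [1 + l p_l] gives the first formula and, since
both steps are reversible, existence and uniqueness ([volterra_solution]).  The
second formula is the first one with the product [(1 + l p_l) (1 + c phi)]
multiplied out ([volterra_solution_direct]).

The coefficient of delta in the forcing term is the value at the origin of the
ABR derivative of the primitive of [f].  That primitive is continuous and
vanishes at the origin, so the coefficient is zero ([ABR_RLI1_0]).

These computations take place in the algebra of locally integrable functions
under convolution, modulo equality almost everywhere; its associativity is
Fubini's theorem after truncation ([convA]).  The kernels are handled term by
term through Euler's Beta integral ([econv_phi], [conv_phi]).  The solution has
the form [a g + b (p_l * g)], and it is Laplace-transformable because [p_l] has
an absolutely convergent Laplace integral and convolution by an absolutely
integrable kernel preserves the convergence of improper integrals
([cvg_primitive_conv]). *)

(** * Reflections and dilations of Lebesgue measure *)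

Section invariance.
Context {R : realType}.
Local Notation mu := (@lebesgue_measure R).

Lemma measurable_subl (r : R) : measurable_fun [set: R] (fun x : R => r - x).
Proof. exact: measurable_funB. Qed.

Lemma preimage_subl_itvoc (r a b : R) :
  (fun x : R => r - x) @^-1` `]a, b] = `[r - b, r - a[%classic.
Proof.
apply/seteqP; split => x /=; rewrite !in_itv/= => /andP[h1 h2];
  by apply/andP; split; lra.
Qed.

Definition reflection (r : R) (x : measurableTypeR R) : measurableTypeR R :=
  (r - x)%R.

Lemma measurable_reflection r : measurable_fun setT (reflection r).
Proof. exact: measurable_subl. Qed.

(** The image of Lebesgue measure, bundled with its measure structure. *)
Definition image_measure (f : measurableTypeR R -> measurableTypeR R)
    (mf : measurable_fun setT f) : {measure set (measurableTypeR R) -> \bar R}.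
Proof. by refine [the measure _ _ of pushforward mu f]. Defined.

Local Notation reflected r := (image_measure (measurable_reflection r)).

(** By uniqueness of Lebesgue measure it suffices to compare the lengths of
intervals. *)
Lemma lebesgue_measure_reflection (r : R) (A : set R) : measurable A ->
  reflected r A = mu A.
Proof.
move=> mA; apply/esym/lebesgue_measure_unique => //= _ [[a b]] _ <-.
rewrite /= /pushforward.
have -> : reflection r @^-1` `]a, b] = `[r - b, r - a[%classic.
  exact: preimage_subl_itvoc.
rewrite !lebesgue_measure_itv/= !lte_fin -EFinB -EFinB.
rewrite ltrD2l ltrN2; case: ifP => // _; congr EFin; lra.
Qed.

Definition scaling (c : R) (x : measurableTypeR R) : measurableTypeR R :=
  (c * x)%R.

Lemma measurable_scaling c : measurable_fun setT (scaling c).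
Proof. exact: measurable_funM. Qed.

Local Open Scope ereal_scope.

Local Notation scaled c := (image_measure (measurable_scaling c)).

Lemma lebesgue_measure_scaling (c : R) (c0 : (0 < c)%R) (A : set R) :
  measurable A -> mscale (NngNum (ltW c0)) (scaled c) A = mu A.
Proof.
move=> mA; apply/esym/lebesgue_measure_unique => //= _ [[a b]] _ <-.
rewrite /mscale /= /pushforward /=.
have -> : scaling c @^-1` `]a, b] =
    `](a / c)%R, (b / c)%R]%classic.
  apply/seteqP; split => x; rewrite /scaling /= !in_itv/=;
   by rewrite ltr_pdivrMr// ler_pdivlMr// ![(x * _)%R]mulrC.
rewrite !lebesgue_measure_itv/= !lte_fin -EFinB -EFinB.
rewrite ltr_pM2r ?invr_gt0//; case: ifP => // _; last by rewrite mule0.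
by rewrite -EFinM -mulrBl mulrC divfK ?gt_eqF.
Qed.

Lemma ge0_integral_reflection (r : R) (F : R -> \bar R) :
  measurable_fun setT F -> (forall x, 0 <= F x) ->
  \int[mu]_x F (r - x)%R = \int[mu]_x F x.
Proof.
move=> mF F0.
rewrite -[RHS](@eq_measure_integral _ _ _ _ _ (reflected r));
  last by move=> A mA _; exact: lebesgue_measure_reflection.
by rewrite (ge0_integral_pushforward (measurable_reflection r))// preimage_setT.
Qed.

Lemma integral_reflection (r : R) (F : R -> \bar R) :
  measurable_fun setT F -> \int[mu]_x F (r - x)%R = \int[mu]_x F x.
Proof.
move=> mF; rewrite integralE [RHS]integralE; congr (_ - _).
  rewrite -[RHS](ge0_integral_reflection r)//; last exact: measurable_funepos.
  by apply: eq_integral => x _; rewrite (funepos_comp F (fun x => r - x)%R).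
rewrite -[RHS](ge0_integral_reflection r)//; last exact: measurable_funeneg.
by apply: eq_integral => x _; rewrite (funeneg_comp F (fun x => r - x)%R).
Qed.

Lemma ge0_integral_scaling (c : R) (F : R -> \bar R) : (0 < c)%R ->
  measurable_fun setT F -> (forall x, 0 <= F x) ->
  \int[mu]_x F (c * x)%R = c^-1%:E * \int[mu]_x F x.
Proof.
move=> c0 mF F0.
have E : \int[scaled c]_x F x = \int[mu]_x F (c * x)%R.
  by rewrite [LHS](ge0_integral_pushforward (measurable_scaling c))//
     preimage_setT.
rewrite -[X in _ * X](@eq_measure_integral _ _ _ _ _
  (mscale (NngNum (ltW c0)) (scaled c)));
  last by move=> A mA _; exact: lebesgue_measure_scaling.
rewrite ge0_integral_mscale// E/= muleA -EFinM mulVf ?gt_eqF//.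
by rewrite mul1e.
Qed.

Lemma Rintegral_reflection (r : R) (f : R -> R) :
  measurable_fun setT f -> (\int[mu]_x f (r - x))%R = (\int[mu]_x f x)%R.
Proof.
move=> mf; congr fine; apply: (@integral_reflection r (EFin \o f)).
exact/measurable_EFinP.
Qed.

End invariance.

(** * Convolution on the line *)

Section full_convolution.
Context {R : realType}.
Local Notation mu := (@lebesgue_measure R).
Implicit Types (f g h : R -> R) (U V : R -> \bar R).

(** One of the integrals of the positive and negative parts is infinite, hence
so is their difference, and [fine] sends infinite values to 0. *)
Lemma Rintegral_nonintegrable (D : set R) f : measurable D ->
  measurable_fun D f -> ~ mu.-integrable D (EFin \o f) ->
  \int[mu]_(x in D) f x = 0.
Proof.
move=> mD mf nf; have mf' :
  measurable_fun D (EFin \o f) by exact/measurable_EFinP.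
rewrite /Rintegral integralE.
set a := (X in (X - _)%E); set b := (X in (_ - X)%E).
have a0 : (0 <= a)%E by exact: integral_ge0.
have b0 : (0 <= b)%E by exact: integral_ge0.
have [/andP[afin bfin]|] := boolP ((a \is a fin_num) && (b \is a fin_num)).
  exfalso; apply: nf; apply/integrableP; split => //.
  rewrite (_ : (fun x => _) = abse \o (EFin \o f))// fune_abse.
  rewrite ge0_integralD//; last 2 first.
  - exact: measurable_funepos.
  - exact: measurable_funeneg.
  by rewrite lte_add_pinfty// -ge0_fin_numE.
rewrite negb_and => /orP[|].
  by rewrite ge0_fin_numE// ltey negbK => /eqP ->; case: (b) b0.
by rewrite ge0_fin_numE// ltey negbK => /eqP ->; case: (a) a0.
Qed.

(** If [f] is not integrable and [c] is not 0, both sides are the default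
value 0. *)
Lemma RintegralMl (D : set R) (c : R) f : measurable D ->
  measurable_fun D f ->
  \int[mu]_(x in D) (c * f x) = c * \int[mu]_(x in D) f x.
Proof.
move=> mD mf; have [->|c0] := eqVneq c 0.
  by under eq_Rintegral do rewrite mul0r; rewrite Rintegral_cst// !mul0r.
have [intf|nf] := pselect (mu.-integrable D (EFin \o f)).
  by rewrite RintegralZl.
rewrite [in RHS]Rintegral_nonintegrable// mulr0 Rintegral_nonintegrable//.
  exact: measurable_funM.
move=> intcf; apply: nf.
have -> : EFin \o f = (fun x : R => (c^-1)%:E * (c * f x)%:E)%E.
  by apply/funext => x /=; rewrite -EFinM mulKf.
exact: integrableZl.
Qed.

Lemma RintegralMr (D : set R) (c : R) f : measurable D ->
  measurable_fun D f ->
  \int[mu]_(x in D) (f x * c) = (\int[mu]_(x in D) f x) * c.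
Proof.
move=> mD mf; rewrite mulrC -RintegralMl//.
by apply: eq_Rintegral => x _; rewrite mulrC.
Qed.

(** Convolution of non-negative functions, used to control absolute
convergence. *)
Definition econv U V (t : R) : \bar R := (\int[mu]_x (U (t - x)%R * V x))%E.

Definition line_conv f g (t : R) : R := \int[mu]_x (f (t - x) * g x).

Local Open Scope ereal_scope.

Lemma measurable_conv_kernel U V : measurable_fun setT U ->
  measurable_fun setT V ->
  measurable_fun setT (fun p : R * R => U (p.1 - p.2)%R * V p.2).
Proof.
move=> mU mV; apply: emeasurable_funM.
  by apply: measurableT_comp => //; exact: measurable_funB.
exact: measurableT_comp.
Qed.

Lemma measurable_econv U V : measurable_fun setT U -> measurable_fun setT V ->
  (forall x, 0 <= U x) -> (forall x, 0 <= V x) ->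
  measurable_fun setT (econv U V).
Proof.
move=> mU mV U0 V0.
apply: (measurable_fun_fubini_tonelli_F (m2 := mu)
  (fun p : R * R => U (p.1 - p.2)%R * V p.2)).
  exact: measurable_conv_kernel.
by move=> p; exact: mule_ge0.
Qed.

Lemma econv_ge0 U V : (forall x, 0 <= U x) -> (forall x, 0 <= V x) ->
  forall t, 0 <= econv U V t.
Proof. by move=> U0 V0 t; apply: integral_ge0 => x _; exact: mule_ge0. Qed.

Lemma ge0_integral_translation (r : R) U : measurable_fun setT U ->
  (forall x, 0 <= U x) -> \int[mu]_x U (x - r)%R = \int[mu]_x U x.
Proof.
move=> mU U0.
have mN : measurable_fun setT (fun x : R => U (0 - x)%R).
  by apply: measurableT_comp => //; exact: measurable_subl.
rewrite -[RHS](ge0_integral_reflection 0)//.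
rewrite -[RHS](ge0_integral_reflection r)//.
by apply: eq_integral => x _; rewrite sub0r opprB.
Qed.

(** Tonelli: the mass of a convolution is the product of the masses. *)
Lemma integral_econv U V : measurable_fun setT U -> measurable_fun setT V ->
  (forall x, 0 <= U x) -> (forall x, 0 <= V x) ->
  \int[mu]_t econv U V t = \int[mu]_x U x * \int[mu]_x V x.
Proof.
move=> mU mV U0 V0.
rewrite [LHS](fubini_tonelli (m1 := mu) (m2 := mu)
  (fun p : R * R => U (p.1 - p.2)%R * V p.2)); last 2 first.
- exact: measurable_conv_kernel.
- by move=> p; exact: mule_ge0.
rewrite /fubini_G /=.
transitivity (\int[mu]_x ((\int[mu]_y U y) * V x)).
  apply: eq_integral => x _; rewrite ge0_integralZr//.
    by rewrite ge0_integral_translation.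
  by apply: (measurableT_comp mU); exact: measurable_funB.
by rewrite ge0_integralZl//; exact: integral_ge0.
Qed.

(** Tonelli's theorem makes the integrals of the positive and of the negative
part of the integrand measurable in [t]. *)
Lemma measurable_line_conv f g : measurable_fun setT f ->
  measurable_fun setT g ->
  measurable_fun setT (line_conv f g).
Proof.
move=> mf mg; rewrite /line_conv /Rintegral.
apply: (@measurableT_comp _ _ _ _ _ _ (@fine R)) => //.
pose k (p : R * R) := (f (p.1 - p.2)%R * g p.2)%:E.
have mk : measurable_fun setT k.
  apply/measurable_EFinP; apply: measurable_funM.
    by apply: measurableT_comp => //; exact: measurable_funB.
  exact: measurableT_comp.
rewrite (_ : (fun t => _) = (fun t => \int[mu]_y k^\+ (t, y) -
  \int[mu]_y k^\- (t, y))); last first.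
  apply/funext => t; rewrite integralE.
  by congr (_ - _); apply: eq_integral => x _;
    rewrite ?(funepos_comp k (fun y => (t, y))) ?(funeneg_comp k (fun y =>
      (t, y))).
apply: emeasurable_funB.
  apply: (measurable_fun_fubini_tonelli_F (m2 := mu) k^\+) => //.
  exact: measurable_funepos.
apply: (measurable_fun_fubini_tonelli_F (m2 := mu) k^\-) => //.
exact: measurable_funeneg.
Qed.

Lemma line_convC f g t : measurable_fun setT f -> measurable_fun setT g ->
  line_conv f g t = line_conv g f t.
Proof.
move=> mf mg; rewrite /line_conv -(Rintegral_reflection t); last first.
  apply: measurable_funM => //.
  by apply: measurableT_comp => //; exact: measurable_subl.
by apply: eq_Rintegral => x _; rewrite mulrC opprB addrCA subrr addr0.
Qed.

Lemma measurable_normE f : measurable_fun setT f ->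
  measurable_fun setT (fun x : R => `|f x|%:E).
Proof. by move=> mf; apply/measurable_EFinP; exact: measurableT_comp. Qed.

(** Fubini, under the hypothesis that the triple convolution of the absolute
values is finite at the point under consideration. *)
Lemma line_convA f g h t : measurable_fun setT f -> measurable_fun setT g ->
  measurable_fun setT h ->
  econv (fun x : R => `|f x|%:E)
    (econv (fun x : R => `|g x|%:E) (fun x : R => `|h x|%:E)) t < +oo ->
  line_conv (line_conv f g) h t = line_conv f (line_conv g h) t.
Proof.
move=> mf mg mh fin.
pose F (p : R * R) := (f (t - p.1)%R * g (p.1 - p.2)%R * h p.2)%:E.
have mF : measurable_fun setT F.
  apply/measurable_EFinP; apply: measurable_funM; last exact: measurableT_comp.
  apply: measurable_funM; apply: measurableT_comp => //; exact: measurable_funB.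
have intF : (mu \x mu).-integrable setT F.
  apply: (proj2 (@integrable12ltyP _ _ _ _ R mu mu F mF));
    apply: le_lt_trans fin.
  rewrite le_eqVlt; apply/orP; left; apply/eqP; apply: eq_integral => z _.
  rewrite -ge0_integralZl//.
    by apply: eq_integral => x _; rewrite /F /= !normrM -!EFinM mulrA.
  apply: emeasurable_funM; last exact: measurable_normE.
  apply: (measurableT_comp (measurable_normE mg)).
  exact: measurable_subl.
rewrite /line_conv /Rintegral; congr fine.
transitivity (\int[mu]_x \int[mu]_z F (z, x)).
  apply: ae_eq_integral => //.
  - apply/measurable_EFinP; apply: measurable_funM => //.
    apply: (measurableT_comp (measurable_line_conv mf mg));
      exact: measurable_subl.
  - exact: measurable_fubini_G intF.
  apply: filterS (ae_integrable2 intF) => x /= intx _.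
  rewrite -(@fineK _ (\int[mu]_z F (z, x))); last exact: integrable_fin_num.
  congr EFin.
  have mfg : measurable_fun setT (fun z : R => f (t - z) * g (z - x))%R.
    apply: measurable_funM; apply: measurableT_comp => //.
      exact: measurable_subl.
    exact: measurable_funB.
  transitivity ((\int[mu]_z (f (t - z) * g (z - x)))%R * h x)%R.
    congr (_ * _)%R.
    rewrite -[RHS](Rintegral_reflection t mfg).
    rewrite -[LHS](line_convC _ mg mf).
    rewrite /line_conv; apply: eq_Rintegral => y _; rewrite mulrC.
    by congr (f _ * g _)%R; lra.
  by rewrite -RintegralMr.
rewrite -(Fubini intF); apply: ae_eq_integral => //.
- exact: measurable_fubini_F intF.
- apply/measurable_EFinP; apply: measurable_funM.
    by apply: measurableT_comp => //; exact: measurable_subl.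
  exact: measurable_line_conv.
apply: filterS (ae_integrable1 intF) => z /= intz _.
rewrite /fubini_F -(@fineK _ (\int[mu]_x F (z, x)));
  last exact: integrable_fin_num.
congr EFin; rewrite -[RHS]RintegralMl//.
  by apply: eq_Rintegral => x _; rewrite mulrA.
apply: measurable_funM => //; apply: measurableT_comp => //.
exact: measurable_subl.
Qed.

End full_convolution.

(** * Convolution of locally integrable functions on the half-line *)

Section local_convolution.
Context {R : realType}.
Local Notation mu := (@lebesgue_measure R).
Implicit Types (u v w : R -> R) (a b c t T : R).

(** The integrability part of [laplace_transformable]. *)
Definition locint u := forall T, mu.-integrable `[0, T] (EFin \o u).

Definition conv u v t := \int[mu]_(x in `[0, t]) (u (t - x) * v x).

Definition aeq u v := {ae mu, forall t, 0 <= t -> u t = v t}.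

Definition trunc T u : R -> R := u \_ `[0, T].

Lemma integrable_itvS a b (f : R -> \bar R) :
  mu.-integrable setT f -> mu.-integrable `[a, b] f.
Proof. by apply: integrableS => //; exact: measurable_itv. Qed.

Lemma trunc_in T u x : 0 <= x <= T -> trunc T u x = u x.
Proof. by move=> h; rewrite /trunc patchE mem_set//= in_itv. Qed.

Lemma trunc_lt0 T u x : x < 0 -> trunc T u x = 0.
Proof.
by move=> x0; rewrite /trunc patchE memNset//= in_itv/= leNgt x0.
Qed.

Lemma trunc_gt T u x : T < x -> trunc T u x = 0.
Proof.
by move=> x0; rewrite /trunc patchE memNset//= in_itv/= andbC leNgt x0.
Qed.

Lemma trunc_integrable T u : locint u ->
  mu.-integrable setT (EFin \o trunc T u).
Proof.
move=> lu; rewrite /trunc -restrict_EFin.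
apply: (proj1 (integrable_mkcond _ _)); first exact: measurable_itv.
exact: lu.
Qed.

Lemma measurable_trunc T u : locint u -> measurable_fun setT (trunc T u).
Proof. by move=> /(trunc_integrable T)/measurable_int/measurable_EFinP. Qed.

Lemma locint_measurable T u : locint u -> measurable_fun `[0, T] u.
Proof. by move=> /(_ T)/measurable_int/measurable_EFinP. Qed.

Lemma conv_lt0 u v t : t < 0 -> conv u v t = 0.
Proof.
by move=> t0; rewrite /conv set_itv_ge ?Rintegral_set0// bnd_simp -ltNge.
Qed.

(** Up to time [T] a convolution on the half-line is a convolution of integrable
functions on the line; this reduces local statements to global ones. *)
Lemma conv_trunc u v t T : t <= T ->
  conv u v t = line_conv (trunc T u) (trunc T v) t.
Proof.
move=> tT; rewrite /conv Rintegral_mkcond; apply: eq_Rintegral => x _.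
rewrite patchE; case: ifPn => [|/negP].
  rewrite inE/= in_itv/= => /andP[x0 xt]; rewrite !trunc_in//; lra.
rewrite inE/= in_itv/= => /negP; rewrite negb_and -!ltNge => /orP[x0|xt].
  by rewrite (trunc_lt0 _ _ x0) mulr0.
by rewrite (@trunc_lt0 _ u) ?mul0r// subr_lt0.
Qed.

Lemma conv_ext u u' v v' t :
  (forall x, 0 <= x <= t -> u x = u' x) ->
  (forall x, 0 <= x <= t -> v x = v' x) -> conv u v t = conv u' v' t.
Proof.
move=> uu' vv'; apply: eq_Rintegral => x /[!inE]/=;
  rewrite in_itv/= => /andP[x0 xt].
by rewrite uu' ?vv' ?x0//; lra.
Qed.

Lemma normr_trunc_lty T u : locint u -> (\int[mu]_x `|trunc T u x|%:E < +oo)%E.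
Proof. by move=> /(trunc_integrable T)/integrableP[]. Qed.

Lemma trunc_econv_lty T u v : locint u -> locint v ->
  (\int[mu]_t econv (fun x : R => `|trunc T u x|%:E) (fun x :
    R => `|trunc T v x|%:E) t < +oo)%E.
Proof.
move=> lu lv; rewrite integral_econv//; last 2 first.
- by apply: measurable_normE; exact: measurable_trunc.
- by apply: measurable_normE; exact: measurable_trunc.
by apply: lte_mul_pinfty; [exact: integral_ge0| |exact: normr_trunc_lty];
  rewrite ge0_fin_numE ?normr_trunc_lty//; exact: integral_ge0.
Qed.

Lemma measurable_trunc_econv T u v : locint u -> locint v ->
  measurable_fun setT
    (econv (fun x : R => `|trunc T u x|%:E) (fun x : R => `|trunc T v x|%:E)).
Proof.
by move=> lu lv; apply: measurable_econv => //; by apply: measurable_normE;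
  exact: measurable_trunc.
Qed.

Lemma ae_impl (P Q : R -> Prop) : (forall t, P t -> Q t) ->
  {ae mu, forall t, P t} -> {ae mu, forall t, Q t}.
Proof.
by move=> PQ; have fmu := ae_filter_ringOfSetsType mu; exact: filterS.
Qed.

Lemma ae_impl2 (P Q S : R -> Prop) : (forall t, P t -> Q t -> S t) ->
  {ae mu, forall t, P t} -> {ae mu, forall t, Q t} -> {ae mu, forall t, S t}.
Proof.
move=> PQS aP aQ; have fmu := ae_filter_ringOfSetsType mu.
by apply: filterS (filterI aP aQ) => t [Pt Qt]; exact: PQS.
Qed.

Lemma ae_and (P Q : R -> Prop) : {ae mu, forall t, P t} ->
  {ae mu, forall t, Q t} -> {ae mu, forall t, P t /\ Q t}.
Proof. by apply: ae_impl2. Qed.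

(** The half-line is a countable union of bounded intervals. *)
Lemma ae_half_line (P : R -> Prop) :
  (forall T, {ae mu, forall t, 0 <= t <= T -> P t}) ->
  {ae mu, forall t, 0 <= t -> P t}.
Proof.
move=> h; have /ae_foralln := fun n : nat => h n%:R.
apply: ae_impl => t ht t0; apply: (ht (Num.truncn t).+1).
by rewrite t0/= ltW// truncnS_gt.
Qed.

(** The convolution of the absolute values of the truncations has a finite
integral, so it is finite almost everywhere. *)
Lemma conv_integrable u v : locint u -> locint v ->
  {ae mu, forall t, 0 <= t ->
    mu.-integrable `[0, t] (EFin \o (fun x => u (t - x) * v x))}.
Proof.
move=> lu lv; apply: ae_half_line => T.
have int : mu.-integrable setT
    (econv (fun x : R => `|trunc T u x|%:E) (fun x : R => `|trunc T v x|%:E)).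
  apply/integrableP; split; first exact: measurable_trunc_econv.
  under eq_integral do rewrite gee0_abs ?econv_ge0//.
  exact: trunc_econv_lty.
have := integrable_ae measurableT int.
apply: ae_impl => t /(_ I) fin /andP[t0 tT].
have : mu.-integrable setT (fun x : R => (trunc T u (t - x) * trunc T v x)%:E).
  apply/integrableP; split.
    apply/measurable_EFinP; apply: measurable_funM;
      last exact: measurable_trunc.
    apply: (measurableT_comp (measurable_trunc T lu)); exact: measurable_subl.
  move: fin; rewrite ge0_fin_numE ?econv_ge0//; apply: le_lt_trans.
  rewrite le_eqVlt; apply/orP; left; apply/eqP; apply: eq_integral => x _.
  by rewrite /= normrM EFinM.
move=> /(integrable_itvS 0 t); apply: eq_integrable => // x;
  rewrite inE/= in_itv/= => /andP[x0 xt].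
by rewrite !trunc_in//; lra.
Qed.

Lemma locint_ext u v : (forall x, 0 <= x -> u x = v x) -> locint u -> locint v.
Proof.
move=> uv lu T; apply: eq_integrable (lu T) => // x; rewrite inE/= in_itv/=.
by case/andP => x0 _; rewrite /= uv.
Qed.

Lemma locint_conv u v : locint u -> locint v -> locint (conv u v).
Proof.
move=> lu lv T.
suff : mu.-integrable setT (EFin \o line_conv (trunc T u) (trunc T v)).
  move=> /(integrable_itvS 0 T); apply: eq_integrable => // x;
    rewrite inE/= in_itv/= => /andP[x0 xt].
  by rewrite -conv_trunc.
apply/integrableP; split.
  by apply/measurable_EFinP; apply: measurable_line_conv;
    exact: measurable_trunc.
apply: le_lt_trans (trunc_econv_lty T lu lv).
apply: ge0_le_integral => //.
- by apply: measurableT_comp => //; apply/measurable_EFinP;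
    apply: measurable_line_conv; exact: measurable_trunc.
- exact: measurable_trunc_econv.
move=> t _ /=; rewrite /econv.
have mk : measurable_fun setT (fun x : R => trunc T u (t - x) * trunc T v x).
  apply: measurable_funM; last exact: measurable_trunc.
  apply: (measurableT_comp (measurable_trunc T lu)); exact: measurable_subl.
have [intk|nk] := pselect (mu.-integrable setT
    (EFin \o (fun x : R => trunc T u (t - x) * trunc T v x))).
  rewrite EFin_normr_Rintegral//.
  apply: (le_trans (le_abse_integral _ _ _)) => //.
    exact: measurable_int intk.
  rewrite le_eqVlt; apply/orP; left; apply/eqP; apply: eq_integral => x _.
  by rewrite /= normrM EFinM.
by rewrite /line_conv Rintegral_nonintegrable// normr0 integral_ge0.
Qed.

Lemma locintZ c u : locint u -> locint (fun x => c * u x).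
Proof.
move=> lu T; rewrite [X in integrable _ _ X](_ : _ =
  (fun x : R => c%:E * (EFin \o u) x)%E)//; exact: integrableZl.
Qed.

Lemma locintD u v : locint u -> locint v -> locint (fun x => u x + v x).
Proof.
by move=> lu lv T; apply: (integrableD _ (lu T) (lv T)); exact: measurable_itv.
Qed.

Lemma measurable_conv_integrand u v t : locint u -> locint v ->
  measurable_fun `[0, t] (fun x => u (t - x) * v x).
Proof.
move=> lu lv; apply: (eq_measurable_fun
    (fun x : R => trunc t u (t - x) * trunc t v x)).
  move=> x; rewrite inE/= in_itv/= => /andP[x0 xt]; rewrite !trunc_in//; lra.
apply: measurable_funTS; apply: measurable_funM; last exact: measurable_trunc.
apply: (measurableT_comp (measurable_trunc t lu)); exact: measurable_subl.
Qed.

Lemma convC u v t : locint u -> locint v -> conv u v t = conv v u t.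
Proof.
by move=> lu lv; rewrite !(conv_trunc _ _ (lexx t)) line_convC//;
  exact: measurable_trunc.
Qed.

Lemma convZr c u v t : locint u -> locint v ->
  conv u (fun x => c * v x) t = c * conv u v t.
Proof.
move=> lu lv; rewrite /conv -RintegralMl//;
  last exact: measurable_conv_integrand.
by apply: eq_Rintegral => x _; rewrite mulrCA.
Qed.

Lemma convZl c u v t : locint u -> locint v ->
  conv (fun x => c * u x) v t = c * conv u v t.
Proof.
move=> lu lv; rewrite /conv -RintegralMl//;
  last exact: measurable_conv_integrand.
by apply: eq_Rintegral => x _; rewrite mulrA.
Qed.

(** The two integrals can be added wherever both integrands are integrable. *)
Lemma convDr u v w : locint u -> locint v -> locint w ->
  aeq (conv u (fun x => v x + w x)) (fun t => conv u v t + conv u w t).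
Proof.
move=> lu lv lw.
apply: ae_impl2 (conv_integrable lu lv) (conv_integrable lu lw) => t i1 i2 t0.
rewrite /conv -RintegralD//; [|exact: i1|exact: i2].
by apply: eq_Rintegral => x _; rewrite mulrDr.
Qed.

Lemma aeq_trans u v w : aeq u v -> aeq v w -> aeq u w.
Proof. by apply: ae_impl2 => t uv vw t0; rewrite uv ?vw. Qed.

Lemma aeq_sym u v : aeq u v -> aeq v u.
Proof. by apply: ae_impl => t uv t0; rewrite uv. Qed.

Lemma aeq_pointwise u v : (forall t, 0 <= t -> u t = v t) -> aeq u v.
Proof. by move=> uv; apply: aeW. Qed.

Lemma convDl u v w : locint u -> locint v -> locint w ->
  aeq (conv (fun x => u x + v x) w) (fun t => conv u w t + conv v w t).
Proof.
move=> lu lv lw; apply: ae_impl (convDr lw lu lv) => t h t0.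
by rewrite convC ?h// 1?(convC _ lw) ?(convC _ lw)//; exact: locintD.
Qed.

(** Integration ignores null sets, hence equality at every point. *)
Lemma aeq_conv u v w t : locint u -> locint v -> locint w -> aeq v w ->
  conv u v t = conv u w t.
Proof.
move=> lu lv lw vw; congr fine; apply: ae_eq_integral => //.
- by apply/measurable_EFinP; exact: measurable_conv_integrand.
- by apply/measurable_EFinP; exact: measurable_conv_integrand.
apply: ae_impl vw => x /= vw; rewrite in_itv/= => /andP[x0 _].
by rewrite vw.
Qed.

Let conv_conv_trunc u v w t T : t <= T ->
  conv (conv u v) w t = line_conv (line_conv (trunc T u) (trunc T v))
    (trunc T w) t /\
  conv u (conv v w) t = line_conv (trunc T u) (line_conv (trunc T v)
    (trunc T w)) t.
Proof.
move=> tT; have trc u' v' s : s <= T ->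
  trunc T (conv u' v') s = line_conv (trunc T u') (trunc T v') s.
  move=> sT; rewrite -conv_trunc//; have [s0|s0] := ltP s 0.
    by rewrite trunc_lt0// conv_lt0.
  by rewrite trunc_in// s0.
rewrite !(conv_trunc _ _ tT); split; apply: eq_Rintegral => x _.
  have [x0|x0] := ltP x 0; first by rewrite (trunc_lt0 _ _ x0) !mulr0.
  by rewrite trc//; lra.
have [xT|xT] := ltP T x; last by rewrite trc.
by rewrite (@trunc_lt0 _ u) ?mul0r//; lra.
Qed.

Let econv3 T u v w := econv (fun x : R => `|trunc T u x|%:E)
  (econv (fun x : R => `|trunc T v x|%:E) (fun x : R => `|trunc T w x|%:E)).

(** Associativity at a point where the truncated triple convolution of the
absolute values is finite. *)
Let convA_at u v w t T : locint u -> locint v -> locint w -> t <= T ->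
  (econv3 T u v w t < +oo)%E -> conv (conv u v) w t = conv u (conv v w) t.
Proof.
move=> lu lv lw tT fin; have [-> ->] := conv_conv_trunc u v w tT.
by apply: line_convA => //; exact: measurable_trunc.
Qed.

(** The triple convolution of the absolute values of the truncations has a
finite integral, the product of three norms, hence is finite almost
everywhere. *)
Lemma convA u v w : locint u -> locint v -> locint w ->
  aeq (conv (conv u v) w) (conv u (conv v w)).
Proof.
move=> lu lv lw; apply: ae_half_line => T.
have e0 t : (0 <= econv3 T u v w t)%E.
  by apply: econv_ge0 => // x; exact: econv_ge0.
have int : mu.-integrable setT (econv3 T u v w).
  apply/integrableP; split.
    apply: measurable_econv => //; last by move=> x; exact: econv_ge0.
      by apply: measurable_normE; exact: measurable_trunc.
    exact: measurable_trunc_econv.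
  under eq_integral do rewrite gee0_abs//.
  rewrite integral_econv//; last 3 first.
  - by apply: measurable_normE; exact: measurable_trunc.
  - exact: measurable_trunc_econv.
  - by move=> x; exact: econv_ge0.
  by apply: lte_mul_pinfty; [exact: integral_ge0| |exact: trunc_econv_lty];
    rewrite ge0_fin_numE ?normr_trunc_lty//; exact: integral_ge0.
have := integrable_ae measurableT int.
apply: ae_impl => t /(_ I) fin /andP[t0 tT].
by apply: (convA_at lu lv lw tT); rewrite -ge0_fin_numE.
Qed.

(** When the first factor is bounded the triple convolution is finite
everywhere, so associativity holds at every point. *)
Lemma convA_bounded u v w t C : locint u -> locint v -> locint w ->
  (forall x, 0 <= x <= t -> `|u x| <= C) ->
  conv (conv u v) w t = conv u (conv v w) t.
Proof.
move=> lu lv lw uC; have [t0|t0] := ltP t 0; first by rewrite !conv_lt0.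
have C0 : 0 <= C by apply: le_trans (uC 0 _); rewrite ?lexx.
apply: (convA_at lu lv lw (lexx t)).
apply: (@le_lt_trans _ _ (C%:E * \int[mu]_x
  econv (fun x : R => `|trunc t v x|%:E) (fun x : R => `|trunc t w x|%:E) x)%E).
  rewrite -ge0_integralZl//; last 2 first.
  - exact: measurable_trunc_econv.
  - by move=> x _; exact: econv_ge0.
  apply: ge0_le_integral => //.
  - by move=> x _; apply: mule_ge0 => //; exact: econv_ge0.
  - apply: emeasurable_funM; last exact: measurable_trunc_econv.
    by apply: (measurableT_comp (measurable_normE (measurable_trunc t lu)));
      exact: measurable_subl.
  - by apply: emeasurable_funM => //; exact: measurable_trunc_econv.
  move=> x _; apply: lee_wpmul2r; first exact: econv_ge0.
  rewrite lee_fin; have [x0|x0] := ltP (t - x) 0.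
    by rewrite trunc_lt0// normr0.
  have [xt|xt] := ltP t (t - x); first by rewrite trunc_gt// normr0.
  by rewrite trunc_in ?x0// uC ?x0.
by apply: lte_mul_pinfty => //; exact: trunc_econv_lty.
Qed.

Lemma locint_conv_op a u v : locint u -> locint v ->
  locint (fun t => a * v t + conv u v t).
Proof. by move=> lu lv; apply: locintD;
  [exact: locintZ|exact: locint_conv]. Qed.

(** Convolution by the measure [a \d_0 + u]. *)
Definition conv_op a u v t := a * v t + conv u v t.

(** The measures [a \d_0 + u] and [b \d_0 + w] are convolved like polynomials;
in this form identities between operators reduce to pointwise identities between
kernels. *)
Lemma conv_op_op a u b w v : locint u -> locint w -> locint v ->
  aeq (conv_op a u (conv_op b w v))
      (conv_op (a * b) (fun x => a * w x + b * u x + conv u w x) v).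
Proof.
move=> lu lw lv.
have luw := locint_conv lu lw; have lwv := locint_conv lw lv.
have l1 := locintZ a lw; have l2 := locintZ b lu; have l12 := locintD l1 l2.
have lbv := locintZ b lv.
have h12 := ae_and (convDr lu lbv lwv) (convA lu lw lv).
have h34 := ae_and (convDl l12 luw lv) (convDl l1 l2 lv).
apply: ae_impl2 h12 h34 => t [h1 h2] [h3 h4] t0.
rewrite /conv_op h1// h3// h4// h2// convZr// !convZl//; ring.
Qed.

Lemma conv_op_ext a u u' v v' t : 0 <= t ->
  (forall x, 0 <= x -> u x = u' x) -> (forall x, 0 <= x -> v x = v' x) ->
  conv_op a u v t = conv_op a u' v' t.
Proof.
move=> t0 uu' vv'; rewrite /conv_op vv'//; congr (_ + _).
by apply: conv_ext => x /andP[x0 _]; [exact: uu'|exact: vv'].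
Qed.

Lemma conv_op_aeq a u v v' : locint u -> locint v -> locint v' -> aeq v v' ->
  aeq (conv_op a u v) (conv_op a u v').
Proof.
move=> lu lv lv' vv'; apply: ae_impl (vv') => t h t0.
by rewrite /conv_op h// (aeq_conv _ lu lv lv' vv').
Qed.

End local_convolution.

(** * The Gamma function *)

Section gamma.
Context {R : realType}.
Local Notation mu := (@lebesgue_measure R).
Implicit Types (a b s t x : R).

Lemma powR_continuous a x : 0 < x -> {for x, continuous (@powR R ^~ a)}.
Proof.
move=> x0; apply: differentiable_continuous; apply/derivable1_diffP.
by apply: derivable_powR; rewrite in_itv/= x0.
Qed.

Lemma integral_powR_itvcc a (e : R) : 0 < a -> 0 < e < 1 ->
  (\int[mu]_(t in `[e, 1%R]) (t `^ (a - 1))%:E = ((1 - e `^ a) / a)%:E)%E.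
Proof.
move=> a0 /andP[e0 e1].
have dF x : 0 < x -> is_derive x 1 (fun x => a^-1 * x `^ a) (x `^ (a - 1)).
  move=> x0; have -> : x `^ (a - 1) = a^-1 *: (a * x `^ (a - 1)).
    by rewrite /GRing.scale/= mulKf// gt_eqF.
  by apply: is_deriveZ; exact: is_derive1_powR.
have cF x : 0 < x -> {for x, continuous (fun x => a^-1 * x `^ a)}.
  move=> x0; apply: differentiable_continuous; apply/derivable1_diffP.
  by apply: ex_derive; exact: dF.
rewrite (@continuous_FTC2 _ _ (fun x => a^-1 * x `^ a))//.
- by rewrite powR1 mulr1 -EFinB; congr EFin; rewrite mulrBl mul1r mulrC.
- apply: continuous_in_subspaceT => x /[!inE]/=;
  rewrite in_itv/= => /andP[ex _].
  by apply: powR_continuous; exact: lt_le_trans ex.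
- split.
  + move=> x; rewrite in_itv/= => /andP[ex _].
    by apply: ex_derive; apply: dF; exact: lt_trans ex.
  + by apply: cvg_at_right_filter; exact: cF.
  + by apply: cvg_at_left_filter; exact: cF.
move=> x; rewrite in_itv/= => /andP[ex _]; rewrite derive1E.
by have [_ ->] := dF x (lt_trans e0 ex).
Qed.

(** Exhaustion of the interval by the segments [[1 / (n + 2), 1]]. *)
Lemma integral_powR_itvoc a : 0 < a ->
  (\int[mu]_(t in `]0%R, 1%R]) (t `^ (a - 1))%:E <= (a^-1)%:E)%E.
Proof.
move=> a0; pose F n := `[(n.+2%:R^-1 : R), 1]%classic.
have -> : `]0, 1]%classic = \bigcup_n F n.
  apply/seteqP; split => [x /=|x [n _]]; rewrite /F /= !in_itv/=.
    move=> /andP[x0 x1]; exists (Num.truncn x^-1) => //.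
    rewrite /F /= in_itv/= x1 andbT invf_ple ?posrE// ltW//.
    by rewrite (lt_trans (truncnS_gt _))// ltr_nat.
  by move=> /andP[nx ->]; rewrite andbT (lt_le_trans _ nx).
have ndF : nondecreasing_seq F.
  apply/nondecreasing_seqP => n; rewrite subsetEset; apply: subset_itvr.
  by rewrite bnd_simp lef_pV2 ?posrE// ler_nat.
have mF n : measurable (F n) by exact: measurable_itv.
have mf n : measurable_fun (F n) (fun t : R => (t `^ (a - 1))%:E).
  by apply/measurable_EFinP; exact: measurable_funTS.
have f0 n x : F n x -> (0 <= (x `^ (a - 1))%:E)%E by rewrite lee_fin powR_ge0.
have /cvg_lim <- // := @ge0_nondecreasing_set_cvg_integral _ (measurableTypeR R)
  R F (fun t : R => (t `^ (a - 1))%:E) mu ndF mF mf f0.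
apply: lime_le.
  apply: ereal_nondecreasing_is_cvgn.
  apply: (@ge0_nondecreasing_set_nondecreasing_integral _ (measurableTypeR R)
    R F (fun t : R => (t `^ (a - 1))%:E) mu ndF mF mf f0).
apply: nearW => n; rewrite integral_powR_itvcc//; last first.
  by rewrite invr_gt0 ltr0n/= invf_lt1// ltr1n.
rewrite lee_fin ler_pdivrMr// mulVf ?gt_eqF// lerBlDr lerDl; exact: powR_ge0.
Qed.

(** The integrand of [Gamma], extended by 0. *)
Definition gamma_kernel a : R -> R :=
  (fun t => t `^ (a - 1) * expR (- t)) \_ `]0, +oo[.

Lemma measurable_gamma_kernel a : measurable_fun setT (gamma_kernel a).
Proof.
apply/measurable_restrict => //; apply: measurable_funTS.
by apply: measurable_funM => //; apply: measurableT_comp.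
Qed.

Lemma gamma_kernel_ge0 a t : 0 <= gamma_kernel a t.
Proof.
by apply: restrict_ge0 => x _; rewrite mulr_ge0 ?powR_ge0 ?expR_ge0.
Qed.

Lemma gamma_kernelE a t : 0 < t -> gamma_kernel a t = t `^ (a - 1) * expR (- t).
Proof. by move=> t0; rewrite /gamma_kernel patchE mem_set//= in_itv/= t0. Qed.

Lemma gamma_kernel_le0 a t : t <= 0 -> gamma_kernel a t = 0.
Proof.
by move=> t0; rewrite /gamma_kernel patchE memNset//= in_itv/= andbT ltNge t0.
Qed.

(** One term of the exponential series dominates the power. *)
Lemma powR_le_expR a : exists2 C, 0 <= C &
  forall t, 1 <= t -> t `^ a <= C * expR (2^-1 * t).
Proof.
pose n := Num.truncn a; pose m := n.+1.
have am : a <= m%:R by rewrite ltW// truncnS_gt.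
exists (m`!%:R * 2 ^+ m); first by rewrite mulr_ge0// exprn_ge0.
move=> t t1; have t0 : 0 <= t by exact: le_trans t1.
apply: (@le_trans _ _ (t ^+ m)).
  by rewrite -powR_mulrn//; exact: ler_powR.
have := @expR_ge1Dxn R (2^-1 * t) n; rewrite -/m => h.
have {h} : (2^-1 * t) ^+ m / m`!%:R <= expR (2^-1 * t).
  apply: le_trans (h _); last by rewrite mulr_ge0.
  by rewrite lerDr.
rewrite ler_pdivrMr ?ltr0n ?fact_gt0// exprMn => h.
have : 2 ^+ m * (2^-1 ^+ m * t ^+ m) <= 2 ^+ m * (expR (2^-1 * t) * m`!%:R).
  by rewrite ler_wpM2l// exprn_ge0.
rewrite mulrA -exprMn mulfV// expr1n mul1r => /le_trans; apply.
by rewrite le_eqVlt; apply/orP; left; apply/eqP; ring.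
Qed.

(** The integrand is dominated by [t `^ (a - 1)] on [[0, 1]] and by a
multiple of an exponential density beyond. *)
Lemma integral_gamma_kernel_lty a : 0 < a ->
  (\int[mu]_t (gamma_kernel a t)%:E < +oo)%E.
Proof.
move=> a0; have [C C0 hC] := powR_le_expR (a - 1).
pose p : R -> R := (fun t => t `^ (a - 1)) \_ `]0, 1].
have mp : measurable_fun setT p.
  by apply/measurable_restrict => //; exact: measurable_funTS.
have p0 t : 0 <= p t by apply: restrict_ge0 => x _; exact: powR_ge0.
have me : measurable_fun setT (exponential_pdf (2^-1 : R)).
  exact: measurable_exponential_pdf.
have e0 t : 0 <= exponential_pdf (2^-1) t :> R by apply: exponential_pdf_ge0.
apply: (@le_lt_trans _ _ (\int[mu]_t ((p t)%:E +
    (2 * C)%:E * (exponential_pdf 2^-1 t)%:E))%E).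
  apply: ge0_le_integral => //.
  - by move=> t _; rewrite lee_fin gamma_kernel_ge0.
  - by apply/measurable_EFinP; exact: measurable_gamma_kernel.
  - apply: emeasurable_funD; first exact/measurable_EFinP.
    by apply: emeasurable_funM => //; exact/measurable_EFinP.
  move=> t _; rewrite -EFinM -EFinD lee_fin.
  have [t0|t0] := leP t 0.
    by rewrite gamma_kernel_le0// addr_ge0// !mulr_ge0.
  rewrite gamma_kernelE//; have [t1|t1] := leP t 1.
    apply: ler_wpDr; first by rewrite !mulr_ge0.
    rewrite /p patchE mem_set/=; last by rewrite in_itv/= t0.
    by rewrite ler_piMr ?powR_ge0// expR_le1 oppr_le0 ltW.
  apply: ler_wpDl => //; rewrite exponential_pdfE ?(ltW t0)//.
  apply: (@le_trans _ _ (C * expR (2^-1 * t) * expR (- t))).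
    by rewrite ler_wpM2r ?expR_ge0// hC// ltW.
  rewrite -mulrA -expRD [_ * C]mulrC -mulrA ler_wpM2l//.
  rewrite mulrA divff// mul1r ler_expR; lra.
have mp' : measurable_fun setT (fun t => (p t)%:E) by exact/measurable_EFinP.
have me' : measurable_fun setT (fun t => (exponential_pdf (2^-1 : R) t)%:E).
  exact/measurable_EFinP.
have e0' t : setT t -> (0 <= (2 * C)%:E * (exponential_pdf (2^-1 : R) t)%:E)%E.
  by move=> _; rewrite -EFinM lee_fin !mulr_ge0.
have p0' t : setT t -> (0 <= (p t)%:E)%E by rewrite lee_fin.
have Cme : measurable_fun setT
    (fun t : R => (2 * C)%:E * (exponential_pdf (2^-1 : R) t)%:E)%E.
  exact: emeasurable_funM.
rewrite (ge0_integralD mu measurableT p0' mp' e0' Cme).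
rewrite ge0_integralZl ?lee_fin ?mulr_ge0//;
  last by move=> t _; rewrite lee_fin.
rewrite integral_exponential_pdf// mule1 lte_add_pinfty// ?ltry//.
apply: (@le_lt_trans _ _ (a^-1)%:E); last exact: ltry.
apply: le_trans (integral_powR_itvoc a0); rewrite [leRHS]integral_mkcond.
rewrite le_eqVlt; apply/orP; left; apply/eqP; apply: eq_integral => x _.
by rewrite /p !patchE; case: ifP.
Qed.

Lemma GammaE a : 0 < a ->
  (\int[mu]_t (gamma_kernel a t)%:E)%E = (Gamma a)%:E.
Proof.
move=> a0; rewrite /Gamma Rintegral_mkcond /Rintegral fineK//.
rewrite ge0_fin_numE ?integral_gamma_kernel_lty// integral_ge0// => t _.
by rewrite lee_fin gamma_kernel_ge0.
Qed.

(** Restricting the integral to [[M, M + 1]]: the Gamma function grows faster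
than every geometric sequence. *)
Lemma Gamma_ge a (M : R) : 0 < a -> 0 < M ->
  M `^ a * (expR (- (M + 1)) / (M + 1)) <= Gamma a.
Proof.
move=> a0 M0; rewrite -lee_fin -GammaE//.
set c := _ * _; have c0 : 0 <= c.
  by rewrite !mulr_ge0 ?powR_ge0 ?expR_ge0// invr_ge0; lra.
apply: (@le_trans _ _ (\int[mu]_(t in `[M, (M + 1)%R]) c%:E)%E).
  rewrite integral_cst//.
  rewrite [X in (_ * X)%E](_ : _ = 1%E) ?mule1//.
  rewrite [LHS]lebesgue_measure_itv/= lte_fin ltrDl ltr01 -EFinD.
  by congr EFin; ring.
apply: (@le_trans _ _ (\int[mu]_(t in `[M, (M + 1)%R])
  (gamma_kernel a t)%:E)%E).
  apply: ge0_le_integral => //.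
  - by apply/measurable_EFinP; apply: measurable_funTS;
      exact: measurable_gamma_kernel.
  move=> t /=; rewrite in_itv/= => /andP[Mt tM]; rewrite lee_fin /c.
  have t0 : 0 < t by exact: lt_le_trans Mt.
  rewrite gamma_kernelE// powRB ?(gt_eqF t0) ?implybT// powRr1 ?(ltW t0)//.
  rewrite [expR _ / _]mulrC mulrA ler_pM ?expR_ge0//.
  - by rewrite mulr_ge0 ?powR_ge0// invr_ge0; lra.
  - rewrite ler_pM ?powR_ge0 ?invr_ge0//; [lra| |].
      by apply: ge0_ler_powR => //; rewrite ?nnegrE; exact: ltW.
    by rewrite lef_pV2 ?posrE//; lra.
  - by rewrite ler_expR; lra.
apply: ge0_subset_integral => //.
- by apply/measurable_EFinP; exact: measurable_gamma_kernel.
- by move=> t _; rewrite lee_fin gamma_kernel_ge0.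
Qed.

Lemma Gamma_gt0 a : 0 < a -> 0 < Gamma a.
Proof.
move=> a0; apply: lt_le_trans (Gamma_ge a0 ltr01).
by rewrite mulr_gt0 ?powR_gt0// divr_gt0 ?expR_gt0.
Qed.

(** The integrand is the density of the exponential law, except at 0. *)
Lemma Gamma1 : Gamma 1 = 1 :> R.
Proof.
apply: EFin_inj; rewrite -(GammaE ltr01).
rewrite -(integral_exponential_pdf (@ltr01 R)).
apply: ae_eq_integral => //.
- by apply/measurable_EFinP; exact: measurable_gamma_kernel.
- by apply/measurable_EFinP; exact: measurable_exponential_pdf.
exists [set 0]; split => //; first exact: lebesgue_measure_set1.
move=> t /= h; apply: contrapT => /eqP t0; apply: h => _; congr EFin.
have [t1|t1|t1] := ltgtP t 0; last by rewrite t1 eqxx in t0.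
  by rewrite gamma_kernel_le0 ?ltW// lt0_exponential_pdf.
rewrite gamma_kernelE// exponential_pdfE ?ltW// subrr powRr0 !mul1r.
by rewrite mulN1r.
Qed.

End gamma.

(** * Power kernels and Euler's Beta integral *)

Section power_kernel.
Context {R : realType}.
Local Notation mu := (@lebesgue_measure R).
Implicit Types (a b s t x : R).

(** The kernel of the Riemann-Liouville integral of order [a], extended by 0. *)
Definition phi a : R -> R := (fun t => t `^ (a - 1) / Gamma a) \_ `]0, +oo[.

Lemma phiE a t : 0 < t -> phi a t = t `^ (a - 1) / Gamma a.
Proof. by move=> t0; rewrite /phi patchE mem_set//= in_itv/= t0. Qed.

Lemma phi_le0 a t : t <= 0 -> phi a t = 0.
Proof.
by move=> t0; rewrite /phi patchE memNset//= in_itv/= andbT ltNge t0.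
Qed.

Lemma phi_ge0 a t : 0 < a -> 0 <= phi a t.
Proof.
move=> a0; apply: restrict_ge0 => x _.
by rewrite mulr_ge0 ?powR_ge0// invr_ge0 ltW// Gamma_gt0.
Qed.

Lemma measurable_phi a : measurable_fun setT (phi a).
Proof.
apply/measurable_restrict => //; apply: measurable_funTS.
by apply: measurable_funM.
Qed.

Lemma measurable_expMx s : measurable_fun setT (fun x : R => expR (- (s * x))).
Proof.
by apply: measurableT_comp => //; apply: measurableT_comp => //;
  exact: measurable_funM.
Qed.

Lemma measurable_exp_phi a s :
  measurable_fun setT (fun x : R => (expR (- (s * x)) * phi a x)%:E).
Proof.
apply/measurable_EFinP; apply: measurable_funM; last exact: measurable_phi.
exact: measurable_expMx.
Qed.

Local Open Scope ereal_scope.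

(** The dilation [x |-> s x] turns the Laplace integral into the Gamma
integral. *)
Lemma laplace_phi a s : (0 < a)%R -> (0 < s)%R ->
  \int[mu]_x (expR (- (s * x)) * phi a x)%:E = (s `^ (- a))%:E.
Proof.
move=> a0 s0; have G0 := Gamma_gt0 a0.
have sa0 : (0 < s `^ (a - 1))%R by rewrite powR_gt0.
pose c := (s `^ (a - 1) * Gamma a)^-1%R.
transitivity (\int[mu]_x (c%:E * (gamma_kernel a (s * x)%R)%:E)).
  apply: eq_integral => x _; rewrite -EFinM; congr EFin.
  have [x0|x0] := leP x 0%R.
    by rewrite phi_le0// gamma_kernel_le0 ?mulr0// pmulr_rle0.
  rewrite phiE// gamma_kernelE ?mulr_gt0// powRM ?ltW// /c; field.
  by rewrite !gt_eqF.
have mg : measurable_fun setT (fun x : R => (gamma_kernel a x)%:E).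
  by apply/measurable_EFinP; exact: measurable_gamma_kernel.
rewrite ge0_integralZl//; first last.
- by rewrite lee_fin invr_ge0 mulr_ge0 ?ltW.
- by move=> x _; rewrite lee_fin gamma_kernel_ge0.
- by apply: (measurableT_comp mg); exact: measurable_funM.
rewrite (ge0_integral_scaling s0 mg); last first.
  by move=> x; rewrite lee_fin gamma_kernel_ge0.
rewrite GammaE// -!EFinM; congr EFin; rewrite powRN /c.
rewrite -(mulr_powRB1 (ltW s0) a0); field.
by rewrite !gt_eqF.
Qed.

(** Homogeneity, by the dilation [x |-> t x]. *)
Let econv_phi_scale a b t : (0 < t)%R -> (0 < a)%R -> (0 < b)%R ->
  econv (EFin \o phi a) (EFin \o phi b) t =
  (t `^ (a + b - 1))%:E * econv (EFin \o phi a) (EFin \o phi b) 1%R.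
Proof.
move=> t0 a0 b0; pose F (x : R) := (phi a (t - x) * phi b x)%:E.
have mF : measurable_fun setT F.
  apply/measurable_EFinP; apply: measurable_funM; last exact: measurable_phi.
  apply: (measurableT_comp (measurable_phi a)); exact: measurable_subl.
have F0 x : 0 <= F x by rewrite lee_fin mulr_ge0// phi_ge0.
have := ge0_integral_scaling t0 mF F0.
rewrite (_ : \int[mu]_x F (t * x)%R = (t `^ (a + b - 2))%:E *
   econv (EFin \o phi a) (EFin \o phi b) 1%R); last first.
  rewrite -ge0_integralZl//; first last.
  - by rewrite lee_fin powR_ge0.
  - by move=> x _; rewrite /= -EFinM lee_fin mulr_ge0// phi_ge0.
  - apply/measurable_EFinP; apply: measurable_funM; last exact: measurable_phi.
    apply: (measurableT_comp (measurable_phi a)); exact: measurable_subl.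
  apply: eq_integral => x _; rewrite /F -!EFinM; congr EFin.
  have [x0|x0] := leP x 0%R.
    by rewrite (phi_le0 b x0) (@phi_le0 b (t * x)) ?mulr0// pmulr_rle0.
  have [x1|x1] := leP 1%R x.
    rewrite (@phi_le0 a (t - t * x)) ?mul0r ?(@phi_le0 a (1 - x))
      ?mul0r ?mulr0//.
      by rewrite subr_le0.
    by rewrite subr_le0 ler_pMr.
  rewrite -{1}(mulr1 t) -mulrBr !phiE ?mulr_gt0 ?subr_gt0//.
  rewrite !powRM ?ltW ?subr_gt0//.
  rewrite (_ : (a + b - 2 = (a - 1) + (b - 1))%R); last by ring.
  rewrite (@powRD _ t (a - 1) (b - 1)) ?(gt_eqF t0) ?implybT//.
  by rewrite [RHS]mulrACA ![in RHS]mulrA ![in LHS]mulrA.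
rewrite -[\int[mu]_x F x]/(econv (EFin \o phi a) (EFin \o phi b) t).
move: (econv _ _ t) (econv _ _ 1%R) => Et E1 h.
have -> : Et = t%:E * (t^-1%:E * Et).
  by rewrite muleA -EFinM mulfV ?gt_eqF// mul1e.
rewrite -h muleA -EFinM; congr (_%:E * _).
rewrite (_ : (a + b - 2 = (a + b - 1) - 1)%R); last by ring.
rewrite powRB ?(gt_eqF t0) ?implybT// powRr1 ?ltW//.
by rewrite mulrCA mulfV ?mulr1// gt_eqF.
Qed.

Lemma econv_phi_le0 a b t : (t <= 0)%R ->
  econv (EFin \o phi a) (EFin \o phi b) t = 0.
Proof.
move=> t0; apply: integral0_eq => x _ /=; rewrite -EFinM.
have [x0|x0] := leP x 0%R; first by rewrite (phi_le0 b x0) mulr0.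
by rewrite (@phi_le0 a (t - x)) ?mul0r//; lra.
Qed.

(** Euler's Beta integral.  By homogeneity the convolution is a multiple of
the power [t `^ (a + b - 1)]; integrating against [exp (- t)] identifies the
constant. *)
Lemma econv_phi a b t : (0 < a)%R -> (0 < b)%R ->
  econv (EFin \o phi a) (EFin \o phi b) t = (phi (a + b) t)%:E.
Proof.
move=> a0 b0; have ab0 : (0 < a + b)%R by exact: addr_gt0.
set k := econv (EFin \o phi a) (EFin \o phi b) 1%R.
have k0 : 0 <= k.
  by apply: econv_ge0 => x; rewrite lee_fin phi_ge0.
have mE c : measurable_fun setT (fun x : R => (expR (- (1 * x)) * phi c x)%:E).
  exact: measurable_exp_phi.
have mass c : (0 < c)%R -> \int[mu]_x (expR (- (1 * x)) * phi c x)%:E = 1.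
  by move=> c0; rewrite (laplace_phi c0 (@ltr01 R)) powR1.
have e0 c : (0 < c)%R -> forall x, 0 <= (expR (- (1 * x)) * phi c x)%:E.
  by move=> c0 x; rewrite lee_fin mulr_ge0 ?expR_ge0 ?phi_ge0.
have : \int[mu]_t ((gamma_kernel (a + b) t)%:E * k) = 1.
  transitivity (\int[mu]_t econv (fun x : R => (expR (- (1 * x)) * phi a x)%:E)
      (fun x : R => (expR (- (1 * x)) * phi b x)%:E) t).
    apply: eq_integral => x _.
    transitivity ((expR (- x))%:E * econv (EFin \o phi a) (EFin \o phi b) x).
      have [x0|x0] := leP x 0%R.
        by rewrite econv_phi_le0// gamma_kernel_le0// mul0e mule0.
      rewrite econv_phi_scale// gamma_kernelE//.
      by rewrite muleA -EFinM mulrC.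
    rewrite -ge0_integralZl//; first last.
    - by move=> y _; rewrite /= -EFinM lee_fin mulr_ge0// phi_ge0.
    - apply/measurable_EFinP; apply: measurable_funM;
      last exact: measurable_phi.
      apply: (measurableT_comp (measurable_phi a)); exact: measurable_subl.
    apply: eq_integral => y _; rewrite -!EFinM; congr EFin.
    rewrite (_ : (- x = (- (1 * (x - y))) + - (1 * y))%R); last by ring.
    by rewrite expRD mulrACA.
  rewrite (integral_econv (mE a) (mE b) (e0 a a0) (e0 b b0)).
  by rewrite (mass a a0) (mass b b0) mule1.
have mg : measurable_fun setT (fun x : R => (gamma_kernel (a + b) x)%:E).
  by apply/measurable_EFinP; exact: measurable_gamma_kernel.
have g0 x : setT x -> 0 <= (gamma_kernel (a + b) x)%:E.
  by rewrite lee_fin gamma_kernel_ge0.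
rewrite ge0_integralZr//.
rewrite GammaE// => kE; have G0 := Gamma_gt0 ab0.
have {}kE : k = (Gamma (a + b))^-1%:E.
  have : (Gamma (a + b))^-1%:E * ((Gamma (a + b))%:E * k) =
    (Gamma (a + b))^-1%:E by rewrite kE mule1.
  by rewrite muleA -EFinM mulVf ?gt_eqF// mul1e.
have [t0|t0] := leP t 0%R; first by rewrite econv_phi_le0// phi_le0.
by rewrite econv_phi_scale// -/k kE -EFinM phiE.
Qed.

(** Below zero both factors vanish, so that the convolution over the whole
line is the one over [[0, t]]. *)
Lemma econv_itv (u v : R -> R) t : (forall x, (x < 0)%R -> u x = 0%R) ->
  (forall x, (x < 0)%R -> v x = 0%R) ->
  \int[mu]_(x in `[0%R, t]) (u (t - x) * v x)%:E =
  econv (EFin \o u) (EFin \o v) t.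
Proof.
move=> u0 v0; rewrite integral_mkcond; apply: eq_integral => x _.
rewrite patchE; case: ifPn => // /negP.
rewrite inE/= in_itv/= -EFinM => /negP; rewrite negb_and -!ltNge => /orP[x0|tx].
  by rewrite v0// mulr0.
by rewrite u0 ?mul0r// subr_lt0.
Qed.

Lemma phi_integrable a b t : (0 < a)%R -> (0 < b)%R ->
  mu.-integrable `[0%R, t] (EFin \o (fun x => phi a (t - x) * phi b x)%R).
Proof.
move=> a0 b0; apply/integrableP; split.
  apply/measurable_EFinP; apply: measurable_funTS.
  apply: measurable_funM; last exact: measurable_phi.
  apply: (measurableT_comp (measurable_phi a)); exact: measurable_subl.
under eq_integral do rewrite /= ger0_norm ?mulr_ge0 ?phi_ge0//.
rewrite econv_itv ?econv_phi ?ltry// => x x0; rewrite phi_le0//; exact: ltW.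
Qed.

Lemma conv_phi a b t : (0 < a)%R -> (0 < b)%R ->
  conv (phi a) (phi b) t = phi (a + b) t.
Proof.
move=> a0 b0; rewrite /conv /Rintegral econv_itv ?econv_phi//;
 by move=> x /ltW; exact: phi_le0.
Qed.

(** On [[0, T]] the weight [expR (- (s * x))] is bounded below. *)
Lemma locint_weighted s (u : R -> R) : (0 < s)%R -> measurable_fun setT u ->
  \int[mu]_x `|expR (- (s * x)) * u x|%:E < +oo -> locint u.
Proof.
move=> s0 mu_ fin T; apply/integrableP; split.
  by apply/measurable_EFinP; exact: measurable_funTS.
have mw : measurable_fun setT (fun x : R => `|expR (- (s * x)) * u x|%:E).
  apply: measurable_normE; apply: measurable_funM => //;
    exact: measurable_expMx.
apply: (@le_lt_trans _ _ (\int[mu]_(x in `[0%R, T])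
    ((expR (s * T))%:E * `|expR (- (s * x)) * u x|%:E))).
  apply: ge0_le_integral => //.
  - by apply: measurableT_comp => //; apply/measurable_EFinP;
    exact: measurable_funTS.
  - by apply: emeasurable_funM => //; exact: measurable_funTS.
  move=> x; rewrite /= in_itv/= => /andP[x0 xT]; rewrite lee_fin normrM.
  rewrite ger0_norm ?expR_ge0// mulrA ler_peMl// -expRD.
  rewrite -[leLHS]expR0 ler_expR subr_ge0 ler_pM2l//.
rewrite ge0_integralZl//; last exact: measurable_funTS.
apply: lte_mul_pinfty; rewrite ?lee_fin ?expR_ge0//.
apply: le_lt_trans fin; apply: ge0_subset_integral => //.
Qed.

Lemma locint_phi a : (0 < a)%R -> locint (phi a).
Proof.
move=> a0; apply: (@locint_weighted 1%R) => //; first exact: measurable_phi.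
under eq_integral do rewrite ger0_norm ?mulr_ge0 ?expR_ge0 ?phi_ge0//.
by rewrite laplace_phi// ltry.
Qed.

End power_kernel.

(** * The Mittag-Leffler kernel *)

Section mittag_leffler_kernel.
Context {R : realType}.
Local Notation mu := (@lebesgue_measure R).
Implicit Types (a b c l s t x : R).

Definition mlterm l a b t : R^nat := fun n => l ^+ n * phi (a * n%:R + b) t.

(** For positive [t] this is [t^(b-1) E_(a,b) (l t^a)], where [E_(a,b)] is the
two-parameter Mittag-Leffler function. *)
Definition mlkernel l a b t : R := limn (series (mlterm l a b t)).

Let idx_gt0 a b n : 0 < a -> 0 < b -> 0 < a * n%:R + b.
Proof. by move=> a0 b0; rewrite ltr_wpDl// mulr_ge0// ltW. Qed.

Lemma powR_arith_prog a b (q : R) n : 0 < a -> 0 < q ->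
  (q `^ a^-1) `^ (a * n%:R + b) = q ^+ n * (q `^ a^-1) `^ b.
Proof.
move=> a0 q0; have Q0 : 0 < q `^ a^-1 by exact: powR_gt0.
rewrite powRD ?(gt_eqF Q0) ?implybT// -powRrM mulrA mulVf ?gt_eqF// mul1r.
by rewrite powR_mulrn// ltW.
Qed.

(** The Gamma function beats every geometric sequence, so the terms of the
Mittag-Leffler series decay geometrically at every point. *)
Lemma mlterm_bound l a b t : 0 < a -> 0 < b ->
  exists2 C, 0 <= C & forall n, `|mlterm l a b t n| <= C * (2^-1) ^+ n.
Proof.
move=> a0 b0; have [t0|t0] := leP t 0.
  by exists 0 => // n; rewrite /mlterm phi_le0// mulr0 normr0 mul0r.
(* [Gamma_ge] is applied with [M = t * q `^ a^-1]: then [M `^ (a * n)] is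
   [t `^ (a * n) * q ^+ n], and [q] is at least twice [`|l|]. *)
pose q : R := 2 * (`|l| + 1); have q0 : 0 < q by rewrite mulr_gt0// ltr_wpDl.
pose Q := q `^ a^-1; have Q0 : 0 < Q by exact: powR_gt0.
pose M := t * Q; have M0 : 0 < M by exact: mulr_gt0.
pose K := expR (- (M + 1)) / (M + 1).
have K0 : 0 < K by rewrite divr_gt0 ?expR_gt0// addr_gt0.
have Qb0 : 0 < Q `^ b by exact: powR_gt0.
have D0 : 0 < (t * K * Q `^ b)^-1.
  by rewrite invr_gt0; apply: mulr_gt0 => //; exact: mulr_gt0.
exists (t * K * Q `^ b)^-1; first exact: ltW.
move=> n; have qn0 : 0 < q ^+ n by exact: exprn_gt0.
 have N0 := idx_gt0 n a0 b0.
rewrite /mlterm normrM normrX (ger0_norm (phi_ge0 _ _))// phiE//.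
have G0 := Gamma_gt0 N0.
have tN : 0 < t `^ (a * n%:R + b) by exact: powR_gt0.
have := Gamma_ge N0 M0; rewrite -/K powRM ?(ltW t0) ?(ltW Q0)//.
rewrite [Q `^ (_ + _)]powR_arith_prog// -/Q => hG.
have : t `^ (a * n%:R + b - 1) / Gamma (a * n%:R + b) <=
    (t * K * Q `^ b)^-1 * (q ^+ n)^-1.
  rewrite powRB ?(gt_eqF t0) ?implybT// powRr1 ?(ltW t0)//.
  rewrite ler_pdivrMr//.
  apply: (@le_trans _ _ ((t * K * Q `^ b)^-1 * (q ^+ n)^-1 *
    (t `^ (a * n%:R + b) * (q ^+ n * Q `^ b) * K))).
    rewrite le_eqVlt; apply/orP; left; apply/eqP; field.
    by rewrite !gt_eqF.
  apply: ler_wpM2l => //; apply: mulr_ge0; first exact: ltW.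
  by rewrite invr_ge0 ltW.
move=> h; apply: (le_trans (ler_wpM2l _ h)); first by rewrite exprn_ge0.
rewrite mulrCA ler_wpM2l//; first exact: ltW.
rewrite -exprVn -exprMn; apply: lerXn2r.
- by rewrite nnegrE mulr_ge0// invr_ge0 ltW.
- by rewrite nnegrE invr_ge0.
by rewrite ler_pdivrMr// /q mulrA mulVf ?pnatr_eq0// mul1r lerDl.
Qed.

Lemma is_cvg_mlterm_norm l a b t : 0 < a -> 0 < b ->
  cvgn (series (fun n => `|mlterm l a b t n|)).
Proof.
move=> a0 b0; have [C C0 h] := mlterm_bound l t a0 b0.
apply: (@series_le_cvg _ _ (geometric C 2^-1)) => //.
- by move=> n; rewrite /= mulr_ge0// exprn_ge0.
- apply: is_cvg_geometric_series; rewrite ger0_norm//; lra.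
Qed.

Lemma is_cvg_mlterm l a b t : 0 < a -> 0 < b ->
  cvgn (series (mlterm l a b t)).
Proof. by move=> a0 b0; apply: normed_cvg; exact: is_cvg_mlterm_norm. Qed.

Lemma mlterm_ge0 l a b t n : 0 < a -> 0 < b -> 0 <= l -> 0 <= mlterm l a b t n.
Proof.
by move=> a0 b0 l0; rewrite mulr_ge0 ?exprn_ge0// phi_ge0// idx_gt0.
Qed.

Lemma norm_mlterm l a b t n : 0 < a -> 0 < b ->
  `|mlterm l a b t n| = mlterm `|l| a b t n.
Proof.
move=> a0 b0; rewrite /mlterm normrM normrX.
by rewrite (ger0_norm (phi_ge0 _ _))// idx_gt0.
Qed.

Lemma norm_series_mlterm l a b t n : 0 < a -> 0 < b ->
  `|series (mlterm l a b t) n| <= mlkernel `|l| a b t.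
Proof.
move=> a0 b0; apply: (le_trans (ler_norm_sum _ _ _)).
under eq_bigr do rewrite norm_mlterm//.
apply: (@nondecreasing_cvgn_le _ (series (mlterm `|l| a b t))).
  by apply: nondecreasing_series => k _ _; exact: mlterm_ge0.
exact: is_cvg_mlterm.
Qed.

Lemma norm_mlkernel l a b t : 0 < a -> 0 < b ->
  `|mlkernel l a b t| <= mlkernel `|l| a b t.
Proof.
move=> a0 b0; rewrite /mlkernel -lim_norm; last exact: is_cvg_mlterm.
apply: limr_le; first by apply: is_cvg_norm; exact: is_cvg_mlterm.
by apply: nearW => n; exact: norm_series_mlterm.
Qed.

Lemma mlkernel_ge0 l a b t : 0 < a -> 0 < b -> 0 <= l -> 0 <= mlkernel l a b t.
Proof.
move=> a0 b0 l0; rewrite -(ger0_norm l0).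
exact: le_trans (norm_mlkernel _ _ _ _).
Qed.

Lemma mlkernel_le0 l a b t : t <= 0 -> mlkernel l a b t = 0.
Proof.
move=> t0; rewrite /mlkernel (_ : mlterm l a b t = cst 0); last first.
  by apply/funext => n; rewrite /mlterm phi_le0// mulr0.
rewrite (_ : series _ = cst 0) ?lim_cst//.
by apply/funext => n; rewrite /series /= big1.
Qed.

Lemma measurable_mlterm l a b n :
  measurable_fun setT (fun t => mlterm l a b t n).
Proof. by apply: measurable_funM => //; exact: measurable_phi. Qed.

Lemma measurable_series_mlterm l a b n :
  measurable_fun setT (fun t => series (mlterm l a b t) n).
Proof. by apply: measurable_sum => k; exact: measurable_mlterm. Qed.

Lemma measurable_mlkernel l a b : 0 < a -> 0 < b ->
  measurable_fun setT (mlkernel l a b).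
Proof.
move=> a0 b0.
apply: (@measurable_fun_cvg _ _ _ _ (fun n t => series (mlterm l a b t) n)).
  by move=> n; exact: measurable_series_mlterm.
by move=> t _; exact: is_cvg_mlterm.
Qed.

(** For non-negative [l] the series may be summed in the extended reals, where
it commutes with integration. *)
Lemma EFin_mlkernel l a b t : 0 < a -> 0 < b -> 0 <= l ->
  (\sum_(0 <= n <oo) (mlterm l a b t n)%:E)%E = (mlkernel l a b t)%:E.
Proof.
move=> a0 b0 l0; rewrite /mlkernel -EFin_lim; last exact: is_cvg_mlterm.
by congr (limn _); apply/funext => n /=; rewrite sumEFin.
Qed.

Lemma econv_phi_mlkernel c l a b t : 0 < a -> 0 < b -> 0 < c -> 0 <= l ->
  econv (EFin \o phi c) (EFin \o mlkernel l a b) t =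
    (mlkernel l a (b + c) t)%:E.
Proof.
move=> a0 b0 c0 l0; have bc0 := addr_gt0 b0 c0.
rewrite -EFin_mlkernel// /econv.
have m1 : measurable_fun setT (fun x : R => phi c (t - x)).
  by apply: (measurableT_comp (measurable_phi c)); exact: measurable_subl.
transitivity (\int[mu]_x \sum_(0 <= n <oo)
    (phi c (t - x) * mlterm l a b x n)%:E)%E.
  apply: eq_integral => x _ /=; rewrite -EFin_mlkernel// -nneseriesZl//.
    by move=> n _; rewrite lee_fin mlterm_ge0.
rewrite integral_nneseries//; last 2 first.
- move=> n; apply/measurable_EFinP; apply: measurable_funM => //.
  exact: measurable_mlterm.
- by move=> n x _; rewrite lee_fin mulr_ge0 ?phi_ge0// mlterm_ge0.
apply: eq_eseriesr => n _.
have -> : mlterm l a (b + c) t n = l ^+ n * phi (c + (a * n%:R + b)) t.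
  by rewrite /mlterm addrA addrC.
rewrite EFinM -econv_phi ?idx_gt0// /econv -ge0_integralZl//; first last.
- by rewrite lee_fin exprn_ge0.
- by move=> x _; rewrite mule_ge0 ?lee_fin ?phi_ge0// idx_gt0.
- have m2 := measurable_phi (a * n%:R + b); apply: emeasurable_funM.
    by apply/measurable_EFinP; exact: m1.
  by apply/measurable_EFinP; exact: m2.
by apply: eq_integral => x _; rewrite /= -!EFinM /mlterm mulrCA.
Qed.

End mittag_leffler_kernel.

(** * Fractional integrals, Laplace integral and continuity of the kernel *)

Section mittag_leffler_calculus.
Context {R : realType}.
Local Notation mu := (@lebesgue_measure R).
Implicit Types (a b c l s t x : R).

Let idx_gt0 a b n : 0 < a -> 0 < b -> 0 < a * n%:R + b.
Proof. by move=> a0 b0; rewrite ltr_wpDl// mulr_ge0// ltW. Qed.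

Lemma conv_phi_series c l a b t n : 0 < a -> 0 < b -> 0 < c ->
  mu.-integrable `[0, t]
    (EFin \o (fun x => phi c (t - x) * series (mlterm l a b x) n)) /\
  conv (phi c) (fun x => series (mlterm l a b x) n) t =
  series (mlterm l a (b + c) t) n.
Proof.
move=> a0 b0 c0; elim: n => [|n [IHi IH]].
  split.
    apply: (eq_integrable _ (cst 0%E)) => //; last exact: integrable0.
    by move=> x _; rewrite /= /series/= big_geq// mulr0.
  rewrite /conv; under eq_Rintegral do rewrite /series/= big_geq// mulr0.
  by rewrite Rintegral_cst// mul0r /series/= big_geq.
have i2 : mu.-integrable `[0, t]
    (EFin \o (fun x => phi c (t - x) * mlterm l a b x n)).
  have iz : mu.-integrable `[0, t] (fun x : R => (l ^+ n)%:E *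
      (phi c (t - x) * phi (a * n%:R + b) x)%:E)%E.
    by apply: integrableZl => //; apply: phi_integrable => //; exact: idx_gt0.
  by apply: eq_integrable iz => // x _; rewrite /mlterm/= -EFinM mulrCA.
have E x : series (mlterm l a b x) n.+1 =
  series (mlterm l a b x) n + mlterm l a b x n.
  by rewrite /series/= big_nat_recr.
split.
  have iD : mu.-integrable `[0, t] (fun x : R =>
      (phi c (t - x) * series (mlterm l a b x) n)%:E +
      (phi c (t - x) * mlterm l a b x n)%:E)%E by apply: integrableD.
  by apply: eq_integrable iD => // x _; rewrite /= E mulrDr.
rewrite /conv; under eq_Rintegral do rewrite E mulrDr.
rewrite RintegralD// -/(conv _ _ _) IH [RHS]/series/= big_nat_recr//=.
congr (_ + _).
under eq_Rintegral do rewrite /mlterm mulrCA.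
rewrite RintegralZl//; last by apply: phi_integrable => //; exact: idx_gt0.
rewrite -[X in _ * X = _]/(conv (phi c) (phi (a * n%:R + b)) t).
rewrite (conv_phi t c0 (idx_gt0 n a0 b0)) /mlterm.
by rewrite (addrC c) -addrA.
Qed.

(** Dominated convergence: the fractional integral of order [c] shifts the
second index of the Mittag-Leffler kernel by [c]. *)
Lemma conv_phi_mlkernel c l a b t : 0 < a -> 0 < b -> 0 < c ->
  conv (phi c) (mlkernel l a b) t = mlkernel l a (b + c) t.
Proof.
move=> a0 b0 c0; have bc0 := addr_gt0 b0 c0.
have m1 : measurable_fun setT (fun x : R => phi c (t - x)).
  by apply: (measurableT_comp (measurable_phi c)); exact: measurable_subl.
pose f_ (n : nat) (x : R) := (phi c (t - x) * series (mlterm l a b x) n)%:E.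
pose f (x : R) := (phi c (t - x) * mlkernel l a b x)%:E.
pose g (x : R) := (phi c (t - x) * mlkernel `|l| a b x)%:E.
have mf_ n : measurable_fun `[0, t] (f_ n).
  apply/measurable_EFinP; apply: measurable_funTS; apply: measurable_funM => //.
  exact: measurable_series_mlterm.
have mf : measurable_fun `[0, t] f.
  apply/measurable_EFinP; apply: measurable_funTS; apply: measurable_funM => //.
  exact: measurable_mlkernel.
have mg : measurable_fun `[0, t] g.
  apply/measurable_EFinP; apply: measurable_funTS; apply: measurable_funM => //.
  exact: measurable_mlkernel.
have ig : mu.-integrable `[0, t] g.
  apply/integrableP; split => //.
  have g0 x : (`|g x| = g x)%E.
    by rewrite gee0_abs// lee_fin mulr_ge0 ?phi_ge0// mlkernel_ge0.
  under eq_integral do rewrite g0.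
  rewrite econv_itv ?econv_phi_mlkernel ?ltry// => x /ltW x0.
    by rewrite phi_le0.
  by rewrite mlkernel_le0.
have f_f : {ae mu, forall x, `[0, t]%classic x -> f_ ^~ x @ \oo --> f x}.
  apply: aeW => x _; apply: cvg_EFin; first exact: nearW.
  by apply: cvgM; [exact: cvg_cst|exact: is_cvg_mlterm].
have f_g : {ae mu, forall x n, `[0, t]%classic x -> (`|f_ n x| <= g x)%E}.
  apply: aeW => x n _; rewrite lee_fin normrM ger0_norm ?phi_ge0//.
  by rewrite ler_wpM2l ?phi_ge0// norm_series_mlterm.
have [_ _ ff] := @dominated_convergence _ _ R mu `[0, t]%classic
  (measurable_itv _) f_ f g mf_ mf f_f ig f_g.
apply: EFin_inj; rewrite /conv /Rintegral fineK; last first.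
  apply: integrable_fin_num => //; apply: le_integrable ig => //.
  move=> x _; rewrite /g /= lee_fin !normrM; apply: ler_wpM2l => //.
  by apply: le_trans (ler_norm _); exact: norm_mlkernel.
rewrite -(cvg_lim _ ff)// /mlkernel -EFin_lim; last exact: is_cvg_mlterm.
congr (limn _); apply/funext => n /=.
have [i <-] := conv_phi_series l t n a0 b0 c0.
by rewrite /conv /Rintegral fineK//; exact: integrable_fin_num.
Qed.

(** Comparison with a geometric series of ratio 1/2. *)
Lemma laplace_mlterm_cvg l a b s : 0 < a -> 0 < b -> 0 < s ->
  2 * `|l| <= s `^ a -> cvgn (series (fun n =>
    `|l| ^+ n * s `^ (- (a * n%:R + b)))).
Proof.
move=> a0 b0 s0 ls; have sa0 : 0 < s `^ a by exact: powR_gt0.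
have sb0 : 0 < s `^ b by exact: powR_gt0.
apply: (@series_le_cvg _ _ (geometric (s `^ b)^-1 2^-1)) => //.
- by move=> n; rewrite mulr_ge0 ?exprn_ge0 ?powR_ge0.
- by move=> n; rewrite /= mulr_ge0 ?exprn_ge0// invr_ge0 ltW.
- move=> n; have -> : `|l| ^+ n * s `^ (- (a * n%:R + b)) =
      (s `^ b)^-1 * (`|l| / s `^ a) ^+ n.
    rewrite powRN (@powRD _ s (a * n%:R) b) ?(gt_eqF s0) ?implybT//.
    rewrite powRrM powR_mulrn ?powR_ge0// invfM exprMn exprVn.
    by rewrite mulrA mulrC.
  apply: ler_wpM2l; first by rewrite invr_ge0 ltW.
  apply: lerXn2r.
  + by rewrite nnegrE mulr_ge0// invr_ge0 ltW.
  + by rewrite nnegrE invr_ge0.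
  by rewrite ler_pdivrMr// ler_pdivlMl.
- by apply: is_cvg_geometric_series; rewrite ger0_norm//; lra.
Qed.

(** The Laplace integral of the kernel converges absolutely on a right
half-line. *)
Lemma laplace_mlkernel_lty l a b s : 0 < a -> 0 < b -> 0 < s ->
  2 * `|l| <= s `^ a ->
  (\int[mu]_x `|expR (- (s * x)) * mlkernel l a b x|%:E < +oo)%E.
Proof.
move=> a0 b0 s0 ls.
have me := measurable_expMx s.
apply: (@le_lt_trans _ _ (\int[mu]_x \sum_(0 <= n <oo)
    (expR (- (s * x)) * mlterm `|l| a b x n)%:E)%E).
  apply: ge0_le_integral => //.
  - apply: measurable_normE; apply: measurable_funM => //.
    exact: measurable_mlkernel.
  - apply: ge0_emeasurable_sum => // n.
      by move=> x _; rewrite lee_fin mulr_ge0 ?expR_ge0// mlterm_ge0.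
    move=> _; apply/measurable_EFinP; apply: measurable_funM => //.
    exact: measurable_mlterm.
  move=> x _; under eq_eseriesr do rewrite EFinM.
  rewrite nneseriesZl//; last by move=> n _; rewrite lee_fin mlterm_ge0.
  rewrite EFin_mlkernel// -EFinM lee_fin normrM ger0_norm ?expR_ge0//.
  by rewrite ler_wpM2l ?expR_ge0// norm_mlkernel.
rewrite integral_nneseries//; last 2 first.
- move=> n; apply/measurable_EFinP; apply: measurable_funM => //.
  exact: measurable_mlterm.
- by move=> n x _; rewrite lee_fin mulr_ge0 ?expR_ge0// mlterm_ge0.
rewrite (@eq_eseriesr _ _ (fun n => (`|l| ^+ n * s `^ (- (a * n%:R + b)))%:E)).
  move: (laplace_mlterm_cvg a0 b0 s0 ls) => line_conv.
  rewrite [X in (X < _)%E](_ : _ = (limn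
    (series (fun n => `|l| ^+ n * s `^ (- (a * n%:R + b)))))%:E) ?ltry//.
  rewrite -EFin_lim//.
  by congr (limn _); apply/funext => n /=; rewrite sumEFin.
move=> n _; have mep := measurable_exp_phi (a * n%:R + b) s.
rewrite EFinM -laplace_phi ?idx_gt0// -ge0_integralZl ?lee_fin ?exprn_ge0//;
  last by move=> x _; rewrite lee_fin mulr_ge0 ?expR_ge0 ?phi_ge0 ?idx_gt0.
by apply: eq_integral => x _; rewrite -EFinM mulrCA.
Qed.

Lemma locint_mlkernel l a b : 0 < a -> 0 < b -> locint (mlkernel l a b).
Proof.
move=> a0 b0; pose q : R := 2 * `|l| + 1.
have q0 : 0 < q by rewrite ltr_wpDl// mulr_ge0.
apply: (@locint_weighted _ (q `^ a^-1)); first exact: powR_gt0.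
  exact: measurable_mlkernel.
apply: laplace_mlkernel_lty => //; first exact: powR_gt0.
by rewrite -powRrM mulVf ?gt_eqF// powRr1 ?(ltW q0)// lerDl.
Qed.

(** The first term of the series is split off. *)
Lemma mlkernel_rec l a b t : 0 < a -> 0 < b ->
  mlkernel l a b t = phi b t + l * mlkernel l a (b + a) t.
Proof.
move=> a0 b0; have ba0 := addr_gt0 b0 a0.
have E n : series (mlterm l a b t) n.+1 =
    phi b t + l * series (mlterm l a (b + a) t) n.
  rewrite /series/= big_nat_recl//= mulr_sumr; congr (_ + _).
    by rewrite /mlterm expr0 mul1r mulr0 add0r.
  apply: eq_bigr => i _; rewrite /mlterm exprS mulrA.
  by rewrite -natr1 mulrDr mulr1 -addrA (addrC a b).
have h : series (mlterm l a b t) n.+1 @[n --> \oo] -->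
    phi b t + l * mlkernel l a (b + a) t.
  under eq_fun do rewrite E.
  apply: cvgD; first exact: cvg_cst.
  by apply: cvgMr => //; exact: is_cvg_mlterm.
by apply: cvg_lim => //; move: h;
  rewrite (cvg_shiftS (series (mlterm l a b t))).
Qed.

(** The defining property of the resolvent of [phi a]. *)
Lemma mlkernel_resolvent l a t : 0 < a ->
  mlkernel l a a t = phi a t + l * conv (phi a) (mlkernel l a a) t.
Proof. by move=> a0; rewrite conv_phi_mlkernel// -mlkernel_rec. Qed.

(** For positive [t] the left-hand side is [mlkernel l a 1 t]; its first term is
1, and the remaining ones form the primitive of [mlkernel l a a]. *)
Lemma mittag_lefflerE l a t : 0 < a -> 0 <= t ->
  mittag_leffler a (l * t `^ a) = 1 + l * conv (phi 1) (mlkernel l a a) t.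
Proof.
move=> a0; rewrite le_eqVlt => /predU1P[<-|t0].
  rewrite powR0 ?gt_eqF// mulr0 conv_phi_mlkernel// mlkernel_le0// mulr0 addr0.
  apply: cvg_lim => //; rewrite -cvg_shiftS.
  apply: cvg_near_cst; apply: nearW => n.
  rewrite /series/= big_nat_recl//= big1 ?addr0.
    by rewrite expr0 mulr0 add0r Gamma1 divr1.
  by move=> i _; rewrite expr0n/= mul0r.
rewrite conv_phi_mlkernel// addrC [X in _ + X](_ : 1 = phi 1 t); last first.
  by rewrite phiE// subrr powRr0 Gamma1 divr1.
rewrite addrC (addrC a 1) -mlkernel_rec//; congr (limn (series _)).
apply/funext => n; rewrite /mlterm phiE ?idx_gt0// addrK exprMn.
by rewrite -(powR_mulrn n (powR_ge0 t a)) -powRrM mulrA.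
Qed.

(** ** Continuity away from the origin *)

(** Coefficients that decay faster than every geometric sequence.  The class is
stable under [pseries_diffs], as differentiating a power series twice
requires. *)
Let rapid (d : R^nat) := forall r : R, 0 <= r ->
  exists2 C, 0 <= C & forall n, `|d n| * r ^+ n <= C * (2^-1) ^+ n.

Let rapid_cvg d r : rapid d -> cvgn (pseries d r).
Proof.
move=> rd; have [C C0 h] := rd `|r| (normr_ge0 r).
apply: normed_cvg; apply: (@series_le_cvg _ _ (geometric C 2^-1)) => //.
- by move=> n; exact: normr_ge0.
- by move=> n; rewrite /= mulr_ge0// exprn_ge0.
- by move=> n; rewrite /= normrM normrX; exact: h.
- by apply: is_cvg_geometric_series; rewrite ger0_norm//; lra.
Qed.

Let rapid_diffs d : rapid d -> rapid (pseries_diffs d).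
Proof.
move=> rd r r0; pose r' := 2 * (r + 1); have r'0 : 0 <= r' by rewrite /r'; lra.
have [C C0 h] := rd r' r'0; exists C => // n.
apply: le_trans (le_trans (h n.+1) _); last first.
  by rewrite ler_wpM2l// exprS ler_piMl ?exprn_ge0//; lra.
rewrite /pseries_diffs normrM normr_nat (mulrC n.+1%:R) -mulrA.
apply: ler_wpM2l => //; rewrite /r' exprMn.
apply: ler_pM => //; first exact: exprn_ge0.
  by rewrite -natrX ler_nat ltnW// ltn_expl.
rewrite exprS; apply: (@le_trans _ _ ((r + 1) ^+ n)).
  by apply: lerXn2r; rewrite ?nnegrE; lra.
by rewrite ler_peMl ?exprn_ge0//; lra.
Qed.

(** The kernel is [t `^ (b - 1)] times an entire function of [l * t `^ a]. *)
Lemma mlkernel_continuous l a b t : 0 < a -> 0 < b -> 0 < t ->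
  {for t, continuous (mlkernel l a b)}.
Proof.
move=> a0 b0 t0; pose d n := (Gamma (a * n%:R + b))^-1.
have rd : rapid d.
  move=> r r0; have [C C0 h] := mlterm_bound r 1 a0 b0; exists C => // n.
  have := h n; rewrite /mlterm phiE// powR1 normrM mul1r mulrC.
  by rewrite (ger0_norm (exprn_ge0 _ r0)).
pose Q z := limn (pseries d z).
have cQ z : {for z, continuous Q}.
  apply: differentiable_continuous; apply/derivable1_diffP.
  have zK : `|z| < `| `|z| + 1 | by rewrite [ltRHS]ger0_norm ?addr_ge0// ltrDl.
  have [dQ _] := pseries_snd_diffs (@rapid_cvg _ _ rd)
    (@rapid_cvg _ _ (rapid_diffs rd))
    (@rapid_cvg _ _ (rapid_diffs (rapid_diffs rd))) zK.
  exact: dQ.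
have E x : 0 < x -> x `^ (b - 1) * Q (l * x `^ a) = mlkernel l a b x.
  move=> x0; apply/esym/cvg_lim => //.
  rewrite (_ : series _ = fun n => x `^ (b - 1) * pseries d (l * x `^ a) n).
    by apply: cvgM; [exact: cvg_cst|exact: rapid_cvg].
  apply/funext => n; rewrite /pseries /series/= mulr_sumr.
  apply: eq_bigr => i _; rewrite /mlterm phiE// /d exprMn.
  rewrite -(powR_mulrn i (powR_ge0 x a)) -powRrM.
  rewrite (_ : a * i%:R + b - 1 = a * i%:R + (b - 1)); last by ring.
  by rewrite (@powRD _ x (a * i%:R) (b - 1)) ?(gt_eqF x0) ?implybT//; ring.
rewrite /prop_for /continuous_at -E//.
apply: (@cvg_trans _ ((fun x => x `^ (b - 1) * Q (l * x `^ a)) @ t)).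
  apply: near_eq_cvg; near=> x; apply: E; near: x; exact: lt_nbhsr.
have h1 : x `^ (b - 1) @[x --> t] --> t `^ (b - 1) by exact: powR_continuous.
have h2 : Q (l * x `^ a) @[x --> t] --> Q (l * t `^ a).
  apply: (@continuous_comp _ _ _ (fun x => l * x `^ a) Q); last exact: cQ.
  by apply: cvgMr; exact: powR_continuous.
exact: (cvgM h1 h2).
Unshelve. all: by end_near. Qed.

End mittag_leffler_calculus.

(** * Primitives and derivatives on the half-line *)

Section differentiation.
Context {R : realType}.
Local Notation mu := (@lebesgue_measure R).
Implicit Types (u v w f : R -> R) (a c t x T : R).

Definition primitive u t := \int[mu]_(x in `[0, t]) u x.

Lemma phi1 t : 0 < t -> phi 1 t = 1.
Proof. by move=> t0; rewrite phiE// subrr powRr0 Gamma1 divr1. Qed.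

Lemma norm_phi1 t : `|phi 1 t| <= 1.
Proof.
have [t0|t0] := leP t 0; first by rewrite phi_le0// normr0.
by rewrite phi1// normr1.
Qed.

(** The two integrands differ at the right end-point only. *)
Lemma conv_phi1 u t : locint u -> conv (phi 1) u t = primitive u t.
Proof.
move=> lu; rewrite /conv /primitive.
have l1 := locint_phi (@ltr01 R).
have m1 := @measurable_conv_integrand _ _ _ t l1 lu.
have m2 := @locint_measurable _ t _ lu.
congr fine; apply: ae_eq_integral => //.
- exact/measurable_EFinP.
- exact/measurable_EFinP.
exists [set t]; split => //; first exact: lebesgue_measure_set1.
move=> x /= h; apply: contrapT => /eqP xt; apply: h.
rewrite in_itv/= => /andP[x0 xlet].
by rewrite phi1 ?mul1r// subr_gt0 lt_neqAle xt.
Qed.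

(** Lebesgue's differentiation theorem, applied to truncations since it is
stated for functions on the line. *)
Lemma ae_FTC u : locint u ->
  {ae mu, forall t, 0 <= t -> 0 < t ->
    (fun h => (primitive u (h + t) - primitive u t) / h) @ 0^' --> u t}.
Proof.
move=> lu; apply: ae_half_line => T.
pose f := trunc (T + 1) u.
have intf : mu.-integrable setT (EFin \o f) by exact: trunc_integrable.
have locf : locally_integrable setT f.
  by apply: open_integrable_locally => //; exact: openT.
have ff y : mu.-integrable [set` Interval (BLeft 0) (BRight y)] (EFin \o f).
  exact: integrable_itvS.
have := FTC1 ff locf; apply: ae_impl => t h /andP[_ tT] t0.
case: h => [|dF F']; first by rewrite ?lte_fin ?lteBSide/= ?ltW.
have PE s : s <= T + 1 ->
    \int[mu]_(x in [set` Interval (BLeft 0) (BRight s)]) f x = primitive u s.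
  move=> sT; apply: eq_Rintegral => x; rewrite inE/= in_itv/= => /andP[x0 xs].
  by rewrite /f trunc_in// x0 (le_trans xs).
have fu : f t = u t by rewrite /f trunc_in// (ltW t0)/= (le_trans tT)// lerDl.
rewrite -fu -F' derive1E; apply: cvg_trans dF.
apply: near_eq_cvg; near=> h => /=.
rewrite /GRing.scale/= mulr1 mulrC !PE//.
- by rewrite (le_trans tT)// lerDl.
rewrite addrC lerD//; apply: (le_trans (ler_norm h)).
by near: h; exact: dnbhs0_le.
Unshelve. all: by end_near. Qed.

(** ** Derivatives on the half-line *)

Lemma increments_proper t : 0 <= t -> ProperFilter (increments t).
Proof.
move=> t0; rewrite /increments; apply: Build_ProperFilter_ex => P.
move=> h.
have hr : \forall e \near (0 : R)^'+, 0 <= t + e -> P e.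
  move: h; rewrite /within /dnbhs /= !near_withinE => h.
  near=> e => e0; have : e != 0 by rewrite gt_eqF.
  near: e; exact: h.
near (0 : R)^'+ => e; have e0 : 0 < e by near: e; exact: nbhs_right_gt.
exists e; have : 0 <= t + e by rewrite addr_ge0// ltW.
by near: e.
Unshelve. all: by end_near. Qed.

Lemma deriv_halfline_cvg F t l : 0 <= t ->
  diff_quotient F t h @[h --> increments t] --> l ->
  derivable_halfline F t /\ deriv_halfline F t = l.
Proof.
move=> t0 Fl; have pf := increments_proper t0; split.
  by apply/cvg_ex; exists l.
by apply: cvg_lim => //; exact: Rhausdorff.
Qed.

Lemma ae_deriv_primitive F u : locint u ->
  (forall t, 0 <= t -> F t = primitive u t) ->
  {ae mu, forall t, 0 <= t ->
    derivable_halfline F t /\ deriv_halfline F t = u t}.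
Proof.
move=> lu FE.
have [N [mN N0 hN]] := ae_FTC lu.
exists (N `|` [set 0]); split.
- exact: measurableU.
- by apply: null_set_setU => //; exact: lebesgue_measure_set1.
move=> t /= ht; have [->|tn0] := eqVneq t 0; first by right.
left; apply: hN => /= hc; apply: ht => t0.
have tgt0 : 0 < t by rewrite lt_neqAle eq_sym tn0.
apply: deriv_halfline_cvg => //.
apply: cvg_trans (hc t0 tgt0).
apply: cvg_trans; last first.
  exact: (cvg_app _ (@cvg_within _ _ _ [set h | 0 <= t + h])).
apply: near_eq_cvg; rewrite near_withinE; near=> h => /= th.
by rewrite /diff_quotient !FE// (addrC h).
Unshelve. all: by end_near. Qed.

(** At the origin, which almost-everywhere statements do not see, the difference
quotient is the mean value of [u]. *)
Lemma deriv_halfline0 F u : locint u ->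
  (forall t, 0 <= t -> F t = primitive u t) -> u x @[x --> 0^'+] --> 0 ->
  derivable_halfline F 0 /\ deriv_halfline F 0 = 0.
Proof.
move=> lu FE u0; apply: deriv_halfline_cvg => //.
apply/cvgrPdist_le => e e0; rewrite near_withinE.
have [d /= d0 hd] : exists2 d, 0 < d & forall x, 0 < x < d -> `|u x| <= e.
  move/cvgrPdist_le : u0 => /(_ _ e0) [d /= d0 hd];
    exists d => // x /andP[x0 xd].
  by have := hd x; rewrite /= !sub0r !normrN gtr0_norm//; apply.
near=> h => /= ; rewrite add0r => h0.
have hn0 : h != 0 by near: h; exact: nbhs_dnbhs_neq.
have hgt0 : 0 < h by rewrite lt_neqAle eq_sym hn0.
have hdd : h < d.
  by rewrite -(gtr0_norm hgt0); near: h; exact: dnbhs0_lt.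
rewrite sub0r normrN /diff_quotient add0r !FE//.
rewrite [X in _ - X](_ : _ = 0) ?subr0; last first.
  by rewrite /primitive set_itv1 Rintegral_set1.
rewrite normrM normfV (gtr0_norm hgt0) ler_pdivrMr//.
apply: (le_trans (le_normr_Rintegral _ (lu h))) => //.
have -> : e * h = \int[mu]_(x in `]0, h]) e.
  rewrite Rintegral_cst//= lebesgue_measure_itv/= lte_fin hgt0.
  by rewrite -EFinB/= subr0.
rewrite -(@Rintegral_itv_obnd_cbnd _ 0 (BRight h) (fun x => `|u x|));
  last first.
  have := integrable_norm (lu h).
  by apply: integrableS => //; apply: subset_itvr; rewrite bnd_simp.
apply: le_Rintegral => //.
- have := integrable_norm (lu h).
  by apply: integrableS => //; apply: subset_itvr; rewrite bnd_simp.
- have ie : mu.-integrable `[0, h] (EFin \o (fun _ : R => e)).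
    apply: continuous_compact_integrable; first exact: segment_compact.
    by apply: continuous_subspaceT => ?; exact: cst_continuous.
  by apply: integrableS ie => //; apply: subset_itvr; rewrite bnd_simp.
move=> x; rewrite /= in_itv/= => /andP[x0 xh].
by apply: hd; rewrite x0 (le_lt_trans xh).
Unshelve. all: by end_near. Qed.

Lemma primitive_cvg0 u : locint u -> primitive u x @[x --> 0^'+] --> 0.
Proof.
move=> lu; apply: cvg_at_right_filter.
by have := parameterized_integral_cvg_left (@ltr01 R) (lu 1).
Qed.

End differentiation.

(** * The ABR derivative and the kernels of the solution formulas *)

Section ABR.
Context {R : realType}.
Local Notation mu := (@lebesgue_measure R).
Implicit Types (u v w f g : R -> R) (alpha k a c l t x T : R).

Lemma conv_integrable_bounded u v t (C : R) : locint u -> locint v ->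
  (forall x, 0 <= x <= t -> `|u x| <= C) ->
  mu.-integrable `[0, t] (EFin \o (fun x => u (t - x) * v x)).
Proof.
move=> lu lv uC; have iC := locintZ C lv t.
apply: le_integrable iC => //.
  by apply/measurable_EFinP; exact: measurable_conv_integrand.
move=> x; rewrite /= in_itv/= => /andP[x0 xt]; rewrite lee_fin !normrM.
apply: ler_wpM2r => //; apply: le_trans (ler_norm C); apply: uC.
by rewrite subr_ge0 xt/= gerBl.
Qed.

Lemma norm_primitive u (s t : R) : locint u -> s <= t ->
  `|primitive u s| <= \int[mu]_(x in `[0, t]) `|u x|.
Proof.
move=> lu st; apply: (le_trans (le_normr_Rintegral _ (lu s))) => //.
have iN T : mu.-integrable `[0, T] (fun x =>
  `|u x|%:E) by exact: (integrable_norm (lu T)).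
apply: fine_le; [exact: integrable_fin_num|exact: integrable_fin_num|].
apply: ge0_subset_integral => //.
- exact: measurable_int (iN t).
- by apply: subset_itvl; rewrite bnd_simp.
Qed.

(** The kernel of the ABR derivative is [1 - c * primitive p], hence the ABR
integral of [f] is a primitive of [f - c (p * f)]. *)
Lemma ABR_integralE alpha f t : 0 < alpha -> locint f -> 0 <= t ->
  let c := alpha / (1 - alpha) in
  let p := mlkernel (- c) alpha alpha in
  ABR_integral alpha f t = primitive (fun x => f x - c * conv p f x) t.
Proof.
move=> al0 lf t0 c p.
have lp : locint p by exact: locint_mlkernel.
have l1 := locint_phi (@ltr01 R).
have lpf := locint_conv lp lf; have lq := locint_conv l1 lp.
have bq x : 0 <= x <= t ->
  `|conv (phi 1) p x| <= \int[mu]_(x in `[0, t]) `|p x|.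
  by move=> /andP[_ xt]; rewrite conv_phi1//; exact: norm_primitive.
have iqf := conv_integrable_bounded lq lf bq.
have icqf : mu.-integrable `[0, t]
    (EFin \o (fun x => c * (conv (phi 1) p (t - x) * f x))).
  by move: iqf; exact: integrableZl.
transitivity (\int[mu]_(x in `[0, t]) (f x - c * (conv (phi 1) p (t - x)
  * f x))).
  apply: eq_Rintegral => x; rewrite inE/= in_itv/= => /andP[x0 xt].
  rewrite mulNr mittag_lefflerE ?subr_ge0// -/c -/p; ring.
rewrite RintegralB; [|exact: measurable_itv|exact: lf|exact: icqf].
rewrite RintegralZl// -[X in _ - _ * X]/(conv (conv (phi 1) p) f t).
rewrite (convA_bounded (C := 1))//; last by move=> x _; exact: norm_phi1.
rewrite conv_phi1// /primitive.
rewrite RintegralB; [|exact: measurable_itv|exact: lf|exact: (locintZ c lpf)].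
by rewrite RintegralZl.
Qed.

Lemma locint_ABR_density alpha f : 0 < alpha -> locint f ->
  let c := alpha / (1 - alpha) in
  let p := mlkernel (- c) alpha alpha in
  locint (fun x => f x - c * conv p f x).
Proof.
move=> al0 lf c p; have lp : locint p by exact: locint_mlkernel.
apply: (@locint_ext _ (fun x => f x + - c * conv p f x)).
  by move=> x _; rewrite mulNr.
by apply: locintD => //; apply: locintZ; exact: locint_conv.
Qed.

Lemma ABR_ae B alpha f : 0 < alpha -> locint f ->
  let c := alpha / (1 - alpha) in
  let p := mlkernel (- c) alpha alpha in
  {ae mu, forall t, 0 <= t -> ABR_derivable alpha f t /\
    ABR B alpha f t = B alpha / (1 - alpha) * (f t - c * conv p f t)}.
Proof.
move=> al0 lf c p; have ld := locint_ABR_density al0 lf.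
have := ae_deriv_primitive ld (fun t => ABR_integralE al0 lf).
apply: ae_impl => t h t0; have [d1 d2] := h t0.
by split => //; rewrite /ABR d2.
Qed.

Lemma RLI1E f t : locint f -> RLI 1 (regular f) t = primitive f t.
Proof.
move=> lf; rewrite /RLI Gamma1 invr1 mul1r /gint /= mul0r addr0.
by apply: eq_Rintegral => x _; rewrite subrr powRr0 mul1r.
Qed.

(** The primitive of [f] vanishes at the origin, hence so does its ABR
derivative. *)
Lemma ABR_RLI1_0 B alpha f : 0 < alpha -> locint f ->
  ABR_derivable alpha (RLI 1 (regular f)) 0 /\
  ABR B alpha (RLI 1 (regular f)) 0 = 0.
Proof.
move=> al0 lf; have -> : RLI 1 (regular f) = primitive f.
  by apply/funext => t; exact: RLI1E.
have l1 := locint_phi (@ltr01 R).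
have lP : locint (primitive f).
  by apply: locint_ext (locint_conv l1 lf) => t _; exact: conv_phi1.
have ld := locint_ABR_density al0 lP.
set c := alpha / (1 - alpha) in ld *;
  set p := mlkernel (- c) alpha alpha in ld *.
have lp : locint p by exact: locint_mlkernel.
have pP x : conv p (primitive f) x = primitive (conv f p) x.
  rewrite convC// -(conv_phi1 _ (locint_conv lf lp)).
  rewrite -(convA_bounded l1 lf lp (fun y _ => norm_phi1 y)).
  by apply: conv_ext => // y _; rewrite conv_phi1.
have d0 : primitive f x - c * conv p (primitive f) x @[x --> 0^'+] --> 0.
  under eq_fun do rewrite pP.
  have h : c * primitive (conv f p) x @[x --> 0^'+] --> c * 0.
    by apply: cvgMr; apply: primitive_cvg0; exact: locint_conv.
  by have := cvgB (primitive_cvg0 lf) h; rewrite mulr0 subr0; apply.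
have [h1 h2] := deriv_halfline0 ld (fun t => ABR_integralE al0 lP) d0.
by split => //; rewrite /ABR h2 mulr0.
Qed.

(** The kernels [(t - x) `^ (alpha - 1)] and [phi alpha (t - x)] agree even at
[x = t], where both are 0 because [alpha] is not 1. *)
Lemma RLIE alpha g t : 0 < alpha < 1 -> locint g ->
  RLI alpha (regular g) t = conv (phi alpha) g t.
Proof.
move=> /andP[al0 al1] lg; rewrite /RLI /gint /= mul0r addr0.
have lphi := locint_phi al0.
have E x : x <= t ->
    (t - x) `^ (alpha - 1) = Gamma alpha * phi alpha (t - x).
  rewrite le_eqVlt => /predU1P[->|xt].
    by rewrite subrr phi_le0// mulr0 powR0// subr_eq0 lt_eqF.
  by rewrite phiE ?subr_gt0// mulrCA mulfV ?mulr1// gt_eqF// Gamma_gt0.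
rewrite /conv -RintegralMl//; last first.
  apply: (eq_measurable_fun
      (fun x => Gamma alpha * (phi alpha (t - x) * g x))).
    move=> x; rewrite inE/= in_itv/= => /andP[_ xt]; rewrite E//.
    by rewrite mulrA.
  by apply: measurable_funM => //; exact: measurable_conv_integrand.
apply: eq_Rintegral => x; rewrite inE/= in_itv/= => /andP[_ xt].
by rewrite E// !mulrA mulVf ?mul1r// gt_eqF// Gamma_gt0.
Qed.

(** By [mittag_lefflerE] the function that is differentiated is a primitive of a
function continuous at [t - x]. *)
Lemma ML_kernelE alpha k t x : 0 < alpha -> x < t ->
  let l := k * alpha / ((1 - k) * (1 - alpha)) in
  ML_kernel alpha k t x = l * mlkernel l alpha alpha (t - x).
Proof.
move=> al0 xt l; pose p := mlkernel l alpha alpha.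
have lp : locint p by exact: locint_mlkernel.
pose s := t - x; have s0 : 0 < s by rewrite subr_gt0.
have s1 : s < s + 1 by rewrite ltrDl.
have [dF F'] := continuous_FTC1_closed s1 (lp (s + 1)) s0
  (@mlkernel_continuous _ l _ _ _ al0 al0 s0).
rewrite /ML_kernel derive1E -/s -/l -/p -F' derive1E.
apply: cvg_lim => //=.
have h : (fun h => l * (h^-1 *: (primitive p (h *: 1 + s) - primitive p s)))
    @ 0^' --> l * 'D_1 (primitive p) s.
  by apply: cvgMr; exact: dF.
apply: cvg_trans h; apply: near_eq_cvg; near=> h => /=.
have sh : 0 <= h + s.
  have : `|h| <= s by near: h; exact: dnbhs0_le.
  by rewrite ler_norml => /andP[+ _]; rewrite -subr_ge0 opprK.
rewrite /GRing.scale/= !mulr1.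
rewrite (_ : h + t - x = h + s); last by rewrite /s addrA.
rewrite -/s !mittag_lefflerE ?(ltW s0)// -/p !conv_phi1//; ring.
Unshelve. all: by end_near. Qed.

(** The two integrands agree on [[0, t[]. *)
Lemma gint_ML_kernel alpha k t w : 0 < alpha -> locint w ->
  let l := k * alpha / ((1 - k) * (1 - alpha)) in
  gint t (ML_kernel alpha k t) (regular w) =
  l * conv (mlkernel l alpha alpha) w t.
Proof.
move=> al0 lw l; have lp :
  locint (mlkernel l alpha alpha) by exact: locint_mlkernel.
have lk := locintZ l lp.
rewrite /gint /= mul0r addr0 -convZl// /conv.
have E : {in `[0, t[%classic, (fun x => ML_kernel alpha k t x * w x) =1
    (fun x => l * mlkernel l alpha alpha (t - x) * w x)}.
  move=> x; rewrite inE/= in_itv/= => /andP[_ xt].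
  by rewrite ML_kernelE.
have m2 : measurable_fun `[0, t]
    (fun x => l * mlkernel l alpha alpha (t - x) * w x).
  exact: measurable_conv_integrand lk lw.
have m3 : measurable_fun `[0, t[
    (fun x => l * mlkernel l alpha alpha (t - x) * w x).
  by apply: measurable_funS m2 => //; apply: subset_itvl; rewrite bnd_simp.
have m1 : measurable_fun `[0, t[ (fun x => ML_kernel alpha k t x * w x).
  by apply: eq_measurable_fun m3 => x xt; rewrite E.
rewrite /Rintegral -!integral_itv_bndo_bndc; last 2 first.
- exact/measurable_EFinP.
- exact/measurable_EFinP.
by congr fine; apply: eq_integral => x xt; rewrite E.
Qed.

End ABR.

(** * Laplace transforms of convolutions *)

Section laplace.
Context {R : realType}.
Local Notation mu := (@lebesgue_measure R).
Implicit Types (u v w f g p : R -> R) (a b c s t x T : R).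

(** The integrand of the Laplace integral of [u] at [s]. *)
Definition damped s u x : R := expR (- (s * x)) * u x.

Lemma locint_damped s u : 0 <= s -> locint u -> locint (damped s u).
Proof.
move=> s0 lu T; apply: le_integrable (lu T) => //.
  apply/measurable_EFinP; apply: measurable_funM; last exact: locint_measurable.
  by apply: measurable_funTS; exact: measurable_expMx.
move=> x; rewrite /= in_itv/= => /andP[x0 _]; rewrite lee_fin normrM.
by rewrite ger0_norm ?expR_ge0// ler_piMl// expR_le1 oppr_le0 mulr_ge0.
Qed.

(** The exponential weight is multiplicative for convolution. *)
Lemma damped_conv s p g t : locint p -> locint g ->
  damped s (conv p g) t = conv (damped s p) (damped s g) t.
Proof.
move=> lp lg; rewrite /damped /conv -RintegralMl//; last first.
  exact: measurable_conv_integrand.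
apply: eq_Rintegral => x _.
rewrite (_ : - (s * t) = - (s * (t - x)) + - (s * x)); last by ring.
by rewrite expRD; ring.
Qed.

(** Near infinity the primitive is close to its limit, and on a bounded interval
it is bounded by the integral of [`|u|]. *)
Lemma bounded_primitive u : locint u -> cvg (primitive u T @[T --> +oo]) ->
  exists2 M, 0 <= M & forall t, `|primitive u t| <= M.
Proof.
move=> lu /cvg_ex[l /= /cvgrPdist_le /(_ 1 ltr01) [Y [_ hY]]].
pose I := \int[mu]_(x in `[0, (Y + 1)]) `|u x|.
have I0 : 0 <= I by apply: Rintegral_ge0.
exists (I + (`|l| + 1)) => [|t]; first by rewrite !addr_ge0.
have [tY|tY] := leP t (Y + 1).
  by rewrite (le_trans (norm_primitive lu tY))// lerDl addr_ge0.
have := hY t; rewrite /= => /(_ (lt_trans _ tY)); rewrite ltrDl => /(_ ltr01) h.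
apply: (@le_trans _ _ (`|l| + 1)); last by rewrite lerDr.
rewrite -[primitive u t](subKr l); apply: (le_trans (ler_normB _ _)).
by rewrite lerD2l.
Qed.

(** Abel-Mertens theorem for integrals: convolving by an absolutely integrable
kernel preserves convergence of improper integrals. *)
Lemma cvg_primitive_conv p g : locint p -> locint g ->
  mu.-integrable setT (EFin \o p) -> (forall x, x < 0 -> p x = 0) ->
  cvg (primitive g T @[T --> +oo]) ->
  cvg (primitive (conv p g) T @[T --> +oo]).
Proof.
move=> lp lg ip p0 cg; have [M M0 hM] := bounded_primitive lg cg.
move/cvg_ex : cg => [l /= gl].
have l1 := locint_phi (@ltr01 R).
have lG : locint (primitive g).
  by apply: locint_ext (locint_conv l1 lg) => t _; exact: conv_phi1.
(* Convolution by [phi 1] is integration from 0, and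
   [phi 1 * (p * g) = (phi 1 * g) * p]. *)
have E T : primitive (conv p g) T =
  \int[mu]_(x in `[0, T]) (primitive g (T - x) * p x).
  rewrite -conv_phi1; last exact: locint_conv.
  rewrite (@conv_ext _ _ (phi 1) _ (conv g p)) => //; last first.
    by move=> x _; exact: convC.
  rewrite -(convA_bounded l1 lg lp (fun y _ => norm_phi1 y)).
  by apply: conv_ext => // x _; exact: conv_phi1.
apply/cvg_ex; exists (l * \int[mu]_x p x); apply/cvg_pinftyP => T_ Ty.
have mp : measurable_fun setT p by move/measurable_int/measurable_EFinP : ip.
pose f_ (n : nat) := (EFin \o (fun x =>
  primitive g (T_ n - x) * p x)) \_ `[0, T_ n].
pose f (x : R) := (l * p x)%:E.
pose h (x : R) := (M * `|p x|)%:E.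
have mf_ n : measurable_fun setT (f_ n).
  apply/measurable_restrict => //; rewrite setTI; apply/measurable_EFinP.
  exact: measurable_conv_integrand.
have mf : measurable_fun setT f.
  by apply/measurable_EFinP; exact: measurable_funM.
have ih : mu.-integrable setT h.
  have := integrableZl measurableT M (integrable_norm ip).
  by apply: eq_integrable.
have f_f : {ae mu, forall x, setT x -> f_ ^~ x @ \oo --> f x}.
  apply: aeW => x _; have [x0|x0] := ltP x 0.
    rewrite /f p0// mulr0; apply: cvg_near_cst; apply: nearW => n.
    by rewrite /f_ patchE; case: ifP => // _; rewrite /= p0// mulr0.
  have Tx : (T_ n - x) @[n --> \oo] --> +oo.
    by apply/cvgryPge => A; near do rewrite lerBrDr; move/cvgryPge : Ty; apply.
  have := cvg_comp _ _ Tx gl => gx.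
  have gpx : (primitive g (T_ n - x) * p x)%:E @[n --> \oo] --> (l * p x)%:E.
    apply: cvg_EFin; first exact: nearW.
    by apply: cvgMl; exact: gx.
  apply: cvg_trans gpx; apply: near_eq_cvg; near=> n.
  rewrite /f_ patchE mem_set//= in_itv/= x0/=.
  by near: n; move/cvgryPge : Ty; apply.
have f_h : {ae mu, forall x n, setT x -> (`|f_ n x| <= h x)%E}.
  apply: aeW => x n _; rewrite /f_ patchE; case: ifP => _.
    by rewrite lee_fin normrM ler_wpM2r.
  by rewrite abse0 lee_fin mulr_ge0.
have [_ _ ff] := @dominated_convergence _ _ R mu setT measurableT f_ f h
  mf_ mf f_f ih f_h.
have fE : (\int[mu]_x f x)%E = (l * \int[mu]_x p x)%:E.
  by rewrite -RintegralZl// /Rintegral fineK//; apply: integrable_fin_num => //;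
    exact: (integrableZl measurableT l ip).
move: ff; rewrite fE => /fine_cvg; apply: cvg_trans; apply: near_eq_cvg.
apply: nearW => n /=; rewrite E /Rintegral; congr fine.
by rewrite [RHS]integral_mkcond.
Unshelve. all: by end_near. Qed.

Lemma laplace_transformable_conv_op a b l alpha g : 0 < alpha ->
  laplace_transformable g ->
  laplace_transformable (conv_op a (fun x => b * mlkernel l alpha alpha x) g).
Proof.
move=> al0 [lg [s0 cg]]; pose p := mlkernel l alpha alpha.
have lp : locint p by exact: locint_mlkernel.
split; first exact: (locint_conv_op a (locintZ b lp) lg).
pose q : R := 2 * `|l| + 1; have q0 : 0 < q by rewrite ltr_wpDl// mulr_ge0.
exists (Num.max (Num.max s0 0) (q `^ alpha^-1)) => s.
rewrite !gt_max => /andP[/andP[ss0 sgt0] sq].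
have lds : locint (damped s g) by apply: locint_damped => //; exact: ltW.
have lps : locint (damped s p) by apply: locint_damped => //; exact: ltW.
have lpsg := locint_conv lps lds.
have ls : 2 * `|l| <= s `^ alpha.
  apply: (@le_trans _ _ q); first by rewrite lerDl.
  have aln0 : alpha != 0 by rewrite gt_eqF.
  rewrite -[q](powRr1 (ltW q0)) -(mulVf aln0) powRrM.
  by apply: ge0_ler_powR; rewrite ?nnegrE ?powR_ge0// ltW.
have ip : mu.-integrable setT (EFin \o damped s p).
  apply/integrableP; split; last exact: laplace_mlkernel_lty.
  apply/measurable_EFinP; apply: measurable_funM; first exact: measurable_expMx.
  exact: measurable_mlkernel.
have cpg : cvg (primitive (conv (damped s p) (damped s g)) T @[T --> +oo]).
  apply: cvg_primitive_conv => //; last exact: cg.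
  by move=> x x0; rewrite /damped /p mlkernel_le0 ?mulr0// ltW.
have E T : \int[mu]_(x in `[0, T])
      (expR (- (s * x)) * conv_op a (fun x => b * p x) g x) =
    a * primitive (damped s g) T +
    b * primitive (conv (damped s p) (damped s g)) T.
  rewrite /primitive.
  rewrite -(RintegralZl a _ (lds T))// -(RintegralZl b _ (lpsg T))//.
  rewrite -RintegralD; [|exact: measurable_itv|exact: (locintZ a lds)
    |exact: (locintZ b lpsg)].
  apply: eq_Rintegral => x _; rewrite -damped_conv// /damped /conv_op convZl//;
    ring.
under eq_fun do rewrite E.
by apply: is_cvgD; apply: is_cvgMr; [exact: (cg s ss0)|exact: cpg].
Qed.

End laplace.

(** * The Volterra equation *)

Section volterra.
Context {R : realType}.
Local Notation mu := (@lebesgue_measure R).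
Implicit Types (u v w f g : R -> R) (alpha a b c k l t x : R).

Lemma aeq_conv_op0 v : aeq (conv_op 1 (fun=> 0) v) v.
Proof.
apply: aeq_pointwise => t _; rewrite /conv_op mul1r /conv.
by under eq_Rintegral do rewrite mul0r; rewrite Rintegral_cst// mul0r addr0.
Qed.

Lemma conv_opZ a b u v t : locint u -> locint v ->
  conv_op a u (fun x => b * v x) t = b * conv_op a u v t.
Proof. by move=> lu lv; rewrite /conv_op convZr//; ring. Qed.

Variable alpha : R.
Hypothesis al0 : 0 < alpha.
Local Notation phi_ := (phi alpha).
Local Notation mlker l := (mlkernel l alpha alpha).

Let lphi : locint phi_. Proof. exact: locint_phi. Qed.
Let lml l : locint (mlker l). Proof. exact: locint_mlkernel. Qed.

(** The product of [1 + l p_l] and [1 - l phi] is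
[1 + l (p_l - phi - l (phi * p_l))], which is 1 by the resolvent identity. *)
Lemma mlkernel_conv_op_left l v : locint v ->
  aeq (conv_op 1 (fun x => l * mlker l x) (conv_op 1 (fun x =>
    - l * phi_ x) v)) v.
Proof.
move=> lv; have l1 := locintZ l (lml l); have l2 := locintZ (- l) lphi.
apply: aeq_trans (conv_op_op 1 1 l1 l2 lv) _.
apply: aeq_trans (aeq_conv_op0 v); apply: aeq_pointwise => t t0; rewrite mul1r.
apply: conv_op_ext => // x _;
  rewrite convZl// convZr// convC// mlkernel_resolvent//.
by ring.
Qed.

Lemma mlkernel_conv_op_right l v : locint v ->
  aeq (conv_op 1 (fun x => - l * phi_ x) (conv_op 1 (fun x =>
    l * mlker l x) v)) v.
Proof.
move=> lv; have l1 := locintZ l (lml l); have l2 := locintZ (- l) lphi.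
apply: aeq_trans (conv_op_op 1 1 l2 l1 lv) _.
apply: aeq_trans (aeq_conv_op0 v); apply: aeq_pointwise => t t0; rewrite mul1r.
apply: conv_op_ext => // x _; rewrite convZl// convZr// mlkernel_resolvent//.
by ring.
Qed.

Variables c k : R.
Hypothesis k1 : k != 1.
Let l := k * c / (1 - k).

(** [(1 + c phi) (1 - k - c p)] is [1 - k + (1 - k) c phi - c (p + c (phi * p))]
with [p = p_(-c)], and the last bracket is [phi]. *)
Lemma volterra_kernel f : locint f ->
  aeq (conv_op 1 (fun x => c * phi_ x) (conv_op (1 - k) (fun x =>
    - c * mlker (- c) x) f))
      (fun t => (1 - k) * conv_op 1 (fun x => - l * phi_ x) f t).
Proof.
move=> lf; have k1' : 1 - k != 0 by rewrite subr_eq0 eq_sym.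
have l1 := locintZ c lphi; have l2 := locintZ (- c) (lml (- c)).
apply: aeq_trans (conv_op_op 1 (1 - k) l1 l2 lf) _.
apply: aeq_pointwise => t t0.
rewrite (@conv_op_ext _ _ _ (fun x => - (k * c) * phi_ x) _ f t)//; last first.
  move=> x _; rewrite convZl// convZr// (mlkernel_resolvent _ _ al0); ring.
by rewrite /conv_op !convZl// /l; field.
Qed.

(** Applying the invertible operator [1 + c phi] to both sides turns the
equation into one whose kernel is a multiple of [phi], which is inverted by the
Mittag-Leffler resolvent. *)
Lemma volterra_solution f g : locint f -> locint g ->
  aeq (conv_op (1 - k) (fun x => - c * mlker (- c) x) f) g <->
  aeq f (conv_op 1 (fun x => l * mlker l x)
    (fun t => (1 - k)^-1 * conv_op 1 (fun x => c * phi_ x) g t)).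
Proof.
move=> lf lg; have k1' : 1 - k != 0 by rewrite subr_eq0 eq_sym.
have lcphi := locintZ c lphi; have lcml := locintZ (- c) (lml (- c)).
have llphi := locintZ (- l) lphi; have llml := locintZ l (lml l).
have lE : locint (conv_op (1 - k) (fun x =>
  - c * mlker (- c) x) f) by exact: locint_conv_op.
have lpg : locint (conv_op 1 (fun x => c * phi_ x) g) by exact: locint_conv_op.
have lH := locintZ (1 - k)^-1 lpg.
have lpf : locint (conv_op 1 (fun x =>
  - l * phi_ x) f) by exact: locint_conv_op.
have lmH : locint (conv_op 1 (fun x => l * mlker l x)
    (fun t => (1 - k)^-1 * conv_op 1 (fun x =>
      c * phi_ x) g t)) by exact: locint_conv_op.
have K := volterra_kernel lf.
split => h.
  have h1 := conv_op_aeq 1 lcphi lE lg h.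
  have h2 : aeq (conv_op 1 (fun x => - l * phi_ x) f)
      (fun t => (1 - k)^-1 * conv_op 1 (fun x => c * phi_ x) g t).
    apply: ae_impl2 h1 K => t e1 e2 t0; rewrite -e1// e2// mulKf//.
  apply: aeq_trans (aeq_sym (mlkernel_conv_op_left l lf)) _.
  exact: conv_op_aeq.
have h1 := conv_op_aeq 1 llphi lf lmH h.
have h2 := aeq_trans h1 (mlkernel_conv_op_right l lH).
have h3 : aeq (conv_op 1 (fun x => c * phi_ x)
      (conv_op (1 - k) (fun x => - c * mlker (- c) x) f))
    (conv_op 1 (fun x => c * phi_ x) g).
  apply: ae_impl2 h2 K => t e1 e2 t0; rewrite e2// e1// mulVKf//.
have inv v : locint v ->
    aeq (conv_op 1 (fun x => - c * mlker (- c) x) (conv_op 1 (fun x =>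
      c * phi_ x) v)) v.
  by move=> lv; have := mlkernel_conv_op_left (- c) lv; rewrite opprK.
have lpE : locint (conv_op 1 (fun x => c * phi_ x)
    (conv_op (1 - k) (fun x =>
      - c * mlker (- c) x) f)) by exact: locint_conv_op.
apply: aeq_trans (aeq_sym (inv _ lE)) _.
apply: aeq_trans (conv_op_aeq 1 lcml lpE lpg h3) _.
exact: inv.
Qed.

(** The kernel of the product [(1 + l p_l) (1 + c phi)] is
[l p_l + c (phi + l (phi * p_l))], that is [(l + c) p_l]. *)
Lemma volterra_solution_direct g : locint g ->
  aeq (conv_op 1 (fun x => l * mlker l x)
        (fun t => (1 - k)^-1 * conv_op 1 (fun x => c * phi_ x) g t))
      (conv_op (1 - k)^-1 (fun x => (1 - k)^-1 * (l + c) * mlker l x) g).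
Proof.
move=> lg; have k1' : 1 - k != 0 by rewrite subr_eq0 eq_sym.
have lcphi := locintZ c lphi; have llml := locintZ l (lml l).
have lpg : locint (conv_op 1 (fun x => c * phi_ x) g) by exact: locint_conv_op.
apply: (@aeq_trans _ _ (fun t => (1 - k)^-1 *
    conv_op 1 (fun x => l * mlker l x) (conv_op 1 (fun x => c * phi_ x) g) t)).
  by apply: aeq_pointwise => t _; rewrite conv_opZ.
have := conv_op_op 1 1 llml lcphi lg; apply: ae_impl => t h t0.
rewrite h// mul1r.
rewrite (@conv_op_ext _ _ _ (fun x => (l + c) * mlker l x) _ g t)//; last first.
  move=> x _; rewrite convZl// convZr// convC//.
  by rewrite [in RHS]mulrDl [in X in _ = _ + X](mlkernel_resolvent _ _ al0);
    ring.
by rewrite /conv_op !convZl//; ring.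
Qed.

End volterra.

(** * The fractional equation *)

Section equation.
Context {R : realType}.
Local Notation mu := (@lebesgue_measure R).
Implicit Types (f g : R -> R) (B : R -> R) (alpha A : R).

(** By [ABR_ae], multiplication of the fractional equation by
[(1 - alpha) / B alpha] gives a Volterra equation. *)
Lemma ABR_solutionE B alpha A g f : 0 < alpha < 1 -> 0 < B alpha -> locint f ->
  let k := (1 - alpha) / B alpha * A in
  let c := alpha / (1 - alpha) in
  ABR_solution B alpha A g f <->
  aeq (conv_op (1 - k) (fun x => - c * mlkernel (- c) alpha alpha x) f)
      (fun t => (1 - alpha) / B alpha * g t).
Proof.
move=> /andP[al0 al1] B0 lf k c.
have lp : locint (mlkernel (- c) alpha alpha) by exact: locint_mlkernel.
have Bn0 : B alpha != 0 by rewrite gt_eqF.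
have aln1 : 1 - alpha != 0 by rewrite subr_eq0 gt_eqF.
have abr := ABR_ae B al0 lf.
split => h.
  apply: ae_impl2 abr h => t ht1 ht2 t0.
  have [_ <-] := ht2 t0; have [_ ->] := ht1 t0.
  by rewrite /conv_op convZl// /k -/c; field; rewrite ?Bn0 ?aln1.
apply: ae_impl2 abr h => t ht1 ht2 t0; have [dt ->] := ht1 t0; split => //.
have := ht2 t0; rewrite /conv_op convZl// => e; rewrite -/c.
apply: (mulfI (mulf_neq0 aln1 (invr_neq0 Bn0))).
by rewrite -e /k; field; rewrite ?Bn0 ?aln1.
Qed.

(** The coefficient of delta is the value computed in [ABR_RLI1_0]. *)
Lemma forcing0 B alpha f g : 0 < alpha -> locint f ->
  forcing B alpha g f = regular g.
Proof.
move=> al0 lf; rewrite /forcing (ABR_RLI1_0 B al0 lf).2 scale0r.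
by rewrite addr0.
Qed.

Lemma regularD (u v : R -> R) :
  regular u + regular v = regular (fun x => u x + v x).
Proof. by congr pair; rewrite /= addr0. Qed.

Lemma regularZ (a : R) (u : R -> R) :
  a *: regular u = regular (fun x => a * u x).
Proof. by congr pair; rewrite /= scaler0. Qed.

(** The AB integral is the operator [gam (1 + c phi)]. *)
Lemma ABI_regular B alpha g : 0 < alpha < 1 -> locint g ->
  ABI B alpha (regular g) = regular (fun t =>
    conv_op 1 (fun x => alpha / (1 - alpha) * phi alpha x)
      (fun x => (1 - alpha) / B alpha * g x) t).
Proof.
move=> al01 lg; have /andP[al0 al1] := al01.
have aln1 : 1 - alpha != 0 by rewrite subr_eq0 gt_eqF.
have lphi := locint_phi al0.
rewrite /ABI !regularZ regularD; congr regular; apply/funext => t.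
rewrite RLIE// conv_opZ//; last exact: locintZ.
by rewrite /conv_op convZl//; move: (B alpha)^-1 => b; field.
Qed.

Lemma solution_ABE B alpha k g : 0 < alpha < 1 -> locint g ->
  let l := k * alpha / ((1 - k) * (1 - alpha)) in
  solution_AB B alpha k (regular g) = regular (conv_op 1
    (fun x => l * mlkernel l alpha alpha x)
    (fun t => (1 - k)^-1 * conv_op 1 (fun x =>
      alpha / (1 - alpha) * phi alpha x)
      (fun x => (1 - alpha) / B alpha * g x) t)).
Proof.
move=> al01 lg l; have /andP[al0 al1] := al01.
have lphi := locint_phi al0; have lml := locint_mlkernel l al0 al0.
pose w := conv_op 1 (fun x => alpha / (1 - alpha) * phi alpha x)
  (fun x => (1 - alpha) / B alpha * g x).
have lw : locint w by apply: locint_conv_op; exact: locintZ.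
rewrite /solution_AB ABI_regular// -/w !regularZ regularD.
congr regular; apply/funext => t.
by rewrite gint_ML_kernel// {1}/conv_op convZr ?convZl ?mul1r//; exact: locintZ.
Qed.

Lemma solution_directE alpha A k g : 0 < alpha < 1 -> locint g ->
  let l := k * alpha / ((1 - k) * (1 - alpha)) in
  solution_direct alpha A k (regular g) = regular (conv_op (k / (A * (1 - k)))
    (fun x => (A * (1 - k))^-1 * l * mlkernel l alpha alpha x) g).
Proof.
move=> /andP[al0 al1] lg l; have lml := locint_mlkernel l al0 al0.
rewrite /solution_direct !regularZ regularD; congr regular; apply/funext => t.
by rewrite gint_ML_kernel// /conv_op convZl// mulrA.
Qed.

Lemma genfun_eq_regular (u v : R -> R) :
  aeq u v -> genfun_eq (regular u) (regular v).
Proof. by []. Qed.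

End equation.

Theorem mainTheorem4 (R : realType) (B : R -> R)
  (B_gt0 : forall a : R, 0 <= a <= 1 -> 0 < B a) (B0 : B 0 = 1) (B1 : B 1 = 1)
  (alpha : R) (alpha01 : 0 < alpha < 1) (A : R)
  (k1 : (1 - alpha) / B alpha * A != 1)
  (g : R -> R) (Lg : laplace_transformable g) :
  let k := (1 - alpha) / B alpha * A in
  exists f : R -> R,
    [/\ laplace_transformable f,
        ABR_solution B alpha A g f,
        forall f' : R -> R,
          laplace_transformable f' -> ABR_solution B alpha A g f' ->
          {ae lebesgue_measure, forall t : R, 0 <= t -> f' t = f t},
        ABR_derivable alpha (RLI 1 (regular f)) 0 &
        let h := forcing B alpha g f in
        genfun_eq (regular f) (solution_AB B alpha k h) /\
        (A != 0 -> genfun_eq (regular f) (solution_direct alpha A k h))].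
Proof.
move=> k; have /andP[al0 al1] := alpha01.
have Bgt0 : 0 < B alpha by apply: B_gt0; rewrite !ltW.
have lg : locint g by case: Lg.
have aln1 : 1 - alpha != 0 by rewrite subr_eq0 gt_eqF.
have k1' : k != 1 by exact: k1.
have kn1 : 1 - k != 0 by rewrite subr_eq0 eq_sym.
pose c := alpha / (1 - alpha); pose l := k * c / (1 - k).
pose gam := (1 - alpha) / B alpha.
have lE : k * alpha / ((1 - k) * (1 - alpha)) = l.
  by rewrite /l /c; field; rewrite kn1.
have lgg : locint (fun x => gam * g x) by exact: locintZ.
have lml : locint (mlkernel l alpha alpha) by exact: locint_mlkernel.
have lphi := locint_phi al0.
pose f := conv_op ((1 - k)^-1 * gam)
  (fun x => (1 - k)^-1 * (l + c) * gam * mlkernel l alpha alpha x) g.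
have Lf : laplace_transformable f by exact: laplace_transformable_conv_op.
have lf : locint f by case: Lf.
pose fAB := conv_op 1 (fun x => l * mlkernel l alpha alpha x)
  (fun t => (1 - k)^-1 * conv_op 1 (fun x => c * phi alpha x)
    (fun x => gam * g x) t).
have ffAB : aeq f fAB.
  apply: aeq_sym.
  apply: aeq_trans (volterra_solution_direct al0 c k1' lgg) _.
  apply: aeq_pointwise => t _; rewrite /f /conv_op !convZl// ?convZr// -/l;
    ring.
have solE f' : locint f' -> ABR_solution B alpha A g f' <-> aeq f' fAB.
  move=> lf'; apply: (iff_trans (ABR_solutionE A g alpha01 Bgt0 lf')).
  exact: (volterra_solution al0 c k1' lf' lgg).
exists f; split => //.
- exact/(solE f lf).
- move=> f' [lf' _] /(solE f' lf') h; exact: aeq_trans h (aeq_sym ffAB).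
- exact: (ABR_RLI1_0 B al0 lf).1.
move=> h; have -> : h = regular g by exact: forcing0.
rewrite (solution_ABE B k alpha01 lg) (solution_directE A k alpha01 lg) lE.
split; first exact: genfun_eq_regular.
move=> A0; apply: genfun_eq_regular; apply: aeq_pointwise => t _.
rewrite /f /conv_op !convZl// -/gam.
have kE : k = gam * A by [].
have -> : k / (A * (1 - k)) = (1 - k)^-1 * gam.
  by rewrite invfM mulrA [X in X / A]kE mulfK//; exact: mulrC.
have -> : (A * (1 - k))^-1 * l = (1 - k)^-1 * (l + c) * gam.
  have -> : l + c = c / (1 - k) by rewrite /l; field.
  have -> : l = gam * A * (c / (1 - k)) by rewrite /l -mulrA.
  have E (X Y G : R) : A^-1 * Y * (G * A * X) = Y * X * G by field.
  by rewrite invfM E.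
by [].
Qed.
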